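(* Let $N\ge2$, $\varepsilon>0$ and $T\in\mathbf N$, $T\ge1$. Let $(\tilde X^{i,I}_t)_{t=0,\dots,T}$, $i\in\mathcal J$, $I\in\mathcal P$, be finite-horizon payoff processes satisfying the finite-horizon assumptions of the context, with payoffs $\tilde J_i$. For $t\in\bar{\mathbf N}$, $i\in\mathcal J$, $I\in\mathcal P$ define $$X^{i,I}_t:=\tilde X^{i,I}_t\ \text{ if }0\le t\le T-1,\qquad X^{i,I}_t:=\tilde X^{i,\mathcal J}_T\ \text{ if }t\ge T,$$ and let $J_i$ be the corresponding infinite-horizon payoffs. Then: (i) The collection $(X^{i,I}_t)_{t\in\bar{\mathbf N}}$ satisfies Assumption (A): $X^{i,\{i,j\}}_t\le X^{i,\{j\}}_t$ $\mathbf P$-a.s. for all $i,j\in\mathcal J$ and $t\in\mathbf N$. (ii) The scheme described in the context, applied to $(X^{i,I})$, provides: (a) $N$ non-increasing sequences of stopping times $(\tau_{Nq+i})_{q\in\mathbf N}$, $i\in\mathcal J$, initialized by $\tau_1=\dots=\tau_N=\infty$; (b) setting $T_i^*:=\lim_{q\to\infty}\tau_{Nq+i}$ for $i\in\mathcal J$, the $N$-tuple $(T_i^* )_{i\in\mathcal J}$ is an $\varepsilon$-Nash equilibrium point of the infinite-horizon game with payoffs $(J_i)_{i\in\mathcal J}$. (iii) For all stopping times $T_1,\dots,T_N\in\mathcal T_0$ and all $i\in\{1,\dots,N\}$, $$J_i(T_1,\dots,T_N)=\tilde J_i(T_1\wedge T,\dots,T_N\wedge T)\quad\mathbf P\text{-a.s.}$$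 Thus, setting $\tilde T_i^*:=T_i^*\wedge T$ for $i\in\mathcal J$, the $N$-tuple $(\tilde T_i^* )_{i\in\mathcal J}$ consists of stopping times with values in $\{0,\dots,T\}$ and is an $\varepsilon$-Nash equilibrium point of the nonzero-sum game with payoffs $(\tilde J_i)_{i\in\{1,\dots,N\}}$.
   Context: General setting. $\mathbf N=\{0,1,2,\dots\}$, $\bar{\mathbf N}=\mathbf N\cup\{\infty\}$. $(\Omega,\mathcal F,\mathbf P)$ is a probability space with a filtration $\mathbf F=(\mathcal F_t)_{t\in\mathbf N}$, and $\mathcal F_\infty:=\mathcal F=\bigvee_{t\ge0}\mathcal F_t$. Stopping times are $\bar{\mathbf N}$-valued; for a stopping time $\theta$, $\mathcal T_\theta$ is the set of $\mathbf F$-stopping times $\tau\ge\theta$. $\mathcal J=\{1,\dots,N\}$ and $\mathcal P$ is the set of nonempty subsets of $\mathcal J$. Finite-horizon assumptions. For all $i\in\mathcal J$, $I\in\mathcal P$, $(\tilde X^{i,I}_t)_{t=0,\dots,T}$ is real-valued, $\mathbf F$-adapted, with $\mathbf E[\max_{0\le t\le T}|\tilde X^{i,I}_t|]<\infty$. For all $t\in\{0,\dots,T\}$ and all $i\ne j$ in $\mathcal J$, $\tilde X^{i,\{i,j\}}_t\le\tilde X^{i,\{j\}}_t$ a.s. For all $i\in\mathcal J$, $I\in\mathcal P$, $\tilde X^{i,I}_T=\tilde X^{i,\mathcal J}_T$. Payoffs. For stopping times $T_1,\dots,T_N$ with values in $\{0,\dots,T\}$ and $R=T_1\wedge\dots\wedge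 T_N$, $$\tilde J_i(T_1,\dots,T_N)=\sum_{I\in\mathcal P}\tilde X^{i,I}_R1_{\bigcap_{j\in I}\{T_j=R\}\cap\bigcap_{j\in I^c}\{T_j>R\}};$$ for $T_1,\dots,T_N\in\mathcal T_0$, $J_i(T_1,\dots,T_N)$ is given by the same formula with $X^{i,I}$ in place of $\tilde X^{i,I}$ (here $I^c=\mathcal J\setminus I$; an empty intersection is $\Omega$). $\varepsilon$-Nash equilibrium point. $(S_1,\dots,S_N)\in\mathcal T_0^N$ is an $\varepsilon$-Nash equilibrium point for payoffs $(J_i)$ if for every $i$ and every $S\in\mathcal T_0$, $\mathbf E[J_i(S_1,\dots,S_{i-1},S,S_{i+1},\dots,S_N)]\le\mathbf E[J_i(S_1,\dots,S_N)]+\varepsilon$. For payoffs $(\tilde J_i)$ the definition is the same, with all stopping times ($S_1,\dots,S_N$ and $S$) valued in $\{0,\dots,T\}$. Scheme. For $n\ge1$ let $(q_n,i_n)$ be the unique pair of integers with $n=Nq_n+i_n$, $i_n\in\{1,\dots,N\}$. Set $\tau_1=\dots=\tau_N=\infty$, and for $n\ge N+1$ define inductively: (a) $\theta_n=\min\{\tau_{n-1},\dots,\tau_{n-(N-1)}\}$; (b) $I_n=\{i_l\in\mathcal J: n-N+1\le l\le n-1,\ \tau_l=\theta_n\}$; (c) for $t\in\bar{\mathbf N}$, $U^n_t=X^{i_n,\{i_n\}}_t1_{\{t<\theta_n\}}+Y^n1_{\{t\ge\theta_n\}}$, where $Y^n=\big(X^{i_n,I_n\cup\{i_n\}}_{\theta_n}\vee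 X^{i_n,I_n}_{\theta_n}\big)1_{\{\theta_n<\infty\}}+X^{i_n,\mathcal J}_\infty1_{\{\theta_n=\infty\}}$; (d) for $t\in\bar{\mathbf N}$, $W^n_t=\operatorname{ess\,sup}_{\nu\in\mathcal T_t}\mathbf E[U^n_\nu\mid\mathcal F_t]$; (e) $\mu_n=\min\{s\in\bar{\mathbf N}: W^n_s\le U^n_s+\varepsilon\}$; (f) $\tau_n=\mu_n\wedge\tau_{n-N}$ on $\{\mu_n\wedge\tau_{n-N}<\theta_n\}$, and $\tau_n=\tau_{n-N}$ on $\{\mu_n\wedge\tau_{n-N}\ge\theta_n\}$. *)

(* Defs.v *)
From HB Require Import structures.
From mathcomp Require Import all_boot all_order all_algebra.
From mathcomp Require Import all_classical all_reals all_analysis.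
From mathcomp Require Import measurable_realfun.

Set Implicit Arguments.
Unset Strict Implicit.
Unset Printing Implicit Defensive.

Import Order.TTheory GRing.Theory Num.Theory.
Import numFieldNormedType.Exports.

Local Open Scope classical_set_scope.
Local Open Scope ring_scope.

(* The set N u {oo}: [None] is oo.  Its topology is that of the one-point
   compactification of the discrete space nat, so a sequence converges to a
   finite m iff it is eventually equal to m, and to oo iff it eventually exceeds
   every natural number. *)
Definition Nbar : Type := one_point_compactification nat.

HB.instance Definition _ := Topological.on Nbar.
HB.instance Definition _ := Pointed.on Nbar.

Definition Fin (t : nat) : Nbar := Some t.
Definition oo : Nbar := None.

Definition Nbar_le (x y : Nbar) : bool :=
  match x, y with
  | _, None => true
  | None, Some _ => false
  | Some s, Some t => (s <= t)%N
  end.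

Fact Nbar_le_refl : reflexive Nbar_le.
Proof. by case=> [s|] //=. Qed.

Fact Nbar_le_anti : antisymmetric Nbar_le.
Proof. by case=> [s|] [t|] //=; rewrite -eqn_leq => /eqP ->. Qed.

Fact Nbar_le_trans : transitive Nbar_le.
Proof. by case=> [s|] [t|] [u|] //=; exact: leq_trans. Qed.

Fact Nbar_le_total : total Nbar_le.
Proof. by case=> [s|] [t|] //=; exact: leq_total. Qed.

Fact Nbar_display : Order.disp_t. Proof. exact: Order.default_display. Qed.

HB.instance Definition _ :=
  Order.Le_isPOrder.Build Nbar_display Nbar
    Nbar_le_refl Nbar_le_anti Nbar_le_trans.
HB.instance Definition _ :=
  Order.POrder_isTotal.Build Nbar_display Nbar Nbar_le_total.

Fact Nbar_lex1 (x : Nbar) : (x <= oo)%O.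
Proof. by case: x. Qed.

HB.instance Definition _ := Order.hasTop.Build Nbar_display Nbar Nbar_lex1.

(* The least element of A, and oo if A contains no natural number. *)
Definition Nbar_inf (A : set Nbar) : Nbar :=
  if pselect (exists t, `[< A (Fin t) >]) is left exA then Fin (ex_minn exA)
  else oo.

Section stochastic_basis.
Context (d : measure_display) (Omega : measurableType d) (R : realType).
Context (P : probability Omega R) (F : nat -> set (set Omega)).

Definition filtration : Prop :=
  [/\ forall t, sigma_algebra setT (F t),
      forall s t, (s <= t)%N -> F s `<=` F t &
      (@measurable _ Omega : set (set Omega)) = <<s \bigcup_t F t >>].

Definition Fbar (t : Nbar) : set (set Omega) :=
  if t is Some s then F s else measurable.

Definition stopping_time (tau : Omega -> Nbar) : Prop :=
  forall t : nat, F t [set w | (tau w <= Fin t)%O].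

Definition stopping_time_le (T : nat) (tau : Omega -> Nbar) : Prop :=
  stopping_time tau /\ forall w, (tau w <= Fin T)%O.

(* g is measurable with respect to the sigma-algebra G. *)
Definition measurable_wrt (d' : measure_display) (S : measurableType d')
    (G : set (set Omega)) (g : Omega -> S) : Prop :=
  measurable_fun [set: g_sigma_algebraType G] (g : g_sigma_algebraType G -> S).

(* g is a version of E[f | G]. *)
Definition cond_exp (G : set (set Omega)) (f g : Omega -> R) : Prop :=
  [/\ measurable_wrt G g,
      P.-integrable setT (EFin \o g) &
      forall A, G A -> (\int[P]_(w in A) (g w)%:E = \int[P]_(w in A) (f w)%:E)%E].

(* Z is a version of the essential supremum of the family Phi of random
   variables (not to be confused with the library's [ess_sup], which is the
   essential supremum of a single function). *)
Definition ess_sup_family (Phi : set (Omega -> \bar R)) (Z : Omega -> \bar R) :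
    Prop :=
  [/\ measurable_fun setT Z,
      forall g, Phi g -> {ae P, forall w, (g w <= Z w)%E} &
      forall Z', measurable_fun setT Z' ->
        (forall g, Phi g -> {ae P, forall w, (g w <= Z' w)%E}) ->
        {ae P, forall w, (Z w <= Z' w)%E}].

(* W is an adapted version of
   t |-> ess sup_(nu stopping time, nu >= t) E[U_nu | F_t], t in N u {oo}. *)
Definition snell_envelope (U : Nbar -> Omega -> R)
    (W : Nbar -> Omega -> \bar R) : Prop :=
  forall t : Nbar,
    measurable_wrt (Fbar t) (W t) /\
    ess_sup_family
      [set EFin \o g | g in [set g | exists nu : Omega -> Nbar,
        [/\ stopping_time nu, (forall w, (t <= nu w)%O) &
            cond_exp (Fbar t) (fun w => U (nu w) w) g]]]
      (W t).

End stochastic_basis.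

Section game.
Context (d : measure_display) (Omega : measurableType d) (R : realType).
Context (P : probability Omega R) (F : nat -> set (set Omega)) (N : nat).

(* Players are 0-based: i : 'I_N stands for the player i + 1.  Coalitions are
   the nonempty sets of players; values of payoff processes at set0 are never
   used. *)

Definition horizon_assumptions (T : nat)
    (Xt : 'I_N -> {set 'I_N} -> nat -> Omega -> R) : Prop :=
  [/\ forall i (I : {set 'I_N}) t, I != finset.set0 -> (t <= T)%N ->
        measurable_wrt (F t) (Xt i I t),
      forall i (I : {set 'I_N}), I != finset.set0 ->
        ('E_P[(fun w => \big[Num.max/0]_(t < T.+1) `|Xt i I t w|)%R] < +oo)%E,
      forall t i j, (t <= T)%N -> i != j ->
        {ae P, forall w, Xt i [set i; j]%SET t w <= Xt i [set j]%SET t w} &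
      forall i (I : {set 'I_N}), I != finset.set0 ->
        {ae P, forall w, Xt i I T w = Xt i [set: 'I_N]%SET T w}].

Definition infinite_extension (T : nat)
    (Xt : 'I_N -> {set 'I_N} -> nat -> Omega -> R)
    (i : 'I_N) (I : {set 'I_N}) (t : Nbar) (w : Omega) : R :=
  if t is Some s then
    if (s < T)%N then Xt i I s w else Xt i [set: 'I_N]%SET T w
  else Xt i [set: 'I_N]%SET T w.

Definition assumption_A (X : 'I_N -> {set 'I_N} -> Nbar -> Omega -> R) : Prop :=
  forall (i j : 'I_N) (t : nat),
    {ae P, forall w,
      X i [set i; j]%SET (Fin t) w <= X i [set j]%SET (Fin t) w}.

Definition first_stop (S : 'I_N -> Omega -> Nbar) (w : Omega) : Nbar :=
  \big[Order.min/oo]_(j < N) S j w.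

Definition payoff (X : 'I_N -> {set 'I_N} -> Nbar -> Omega -> R) (i : 'I_N)
    (S : 'I_N -> Omega -> Nbar) (w : Omega) : R :=
  \sum_(I : {set 'I_N} | I != finset.set0)
    X i I (first_stop S w) w *
    \1_[set w' | (forall j, j \in I -> S j w' = first_stop S w') /\
                 (forall j, j \notin I -> (first_stop S w' < S j w')%O)] w.

(* The payoffs of the game with horizon T are those of a process indexed by
   {0, ..., T}, evaluated at stopping times bounded by T: the value 0 below is
   never reached. *)
Definition finite_payoff (Xt : 'I_N -> {set 'I_N} -> nat -> Omega -> R) :
    'I_N -> ('I_N -> Omega -> Nbar) -> Omega -> R :=
  payoff (fun i I t w => if t is Some s then Xt i I s w else 0).

(* S is an eps-Nash equilibrium point for the payoffs J, all players choosing
   their stopping times in the class adm. *)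
Definition nash (adm : (Omega -> Nbar) -> Prop)
    (J : 'I_N -> ('I_N -> Omega -> Nbar) -> Omega -> R) (eps : R)
    (S : 'I_N -> Omega -> Nbar) : Prop :=
  (forall i, adm (S i)) /\
  forall (i : 'I_N) (S' : Omega -> Nbar), adm S' ->
    ('E_P[J i (fun j => if j == i then S' else S j)]
       <= 'E_P[J i S] + eps%:E)%E.

(* For n >= 1, the 0-based player i with n = N * q + (i + 1). *)
Definition player (hN : (1 < N)%N) (n : nat) : 'I_N :=
  Ordinal (ltn_pmod n.-1 (ltnW hN)).

Section scheme.
Context (hN : (1 < N)%N) (eps : R).
Context (X : 'I_N -> {set 'I_N} -> Nbar -> Omega -> R).
Context (tau : nat -> Omega -> Nbar).

Definition theta (n : nat) (w : Omega) : Nbar :=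
  \big[Order.min/oo]_(n - N + 1 <= l < n) tau l w.

Definition stoppers (n : nat) (w : Omega) : {set 'I_N} :=
  [set player hN l | l : 'I_n & (n - N + 1 <= l)%N && (tau l w == theta n w)]%SET.

Definition Y (n : nat) (w : Omega) : R :=
  let i := player hN n in
  if theta n w is Some _ then
    Num.max (X i (stoppers n w :|: [set i])%SET (theta n w) w)
            (X i (stoppers n w) (theta n w) w)
  else X i [set: 'I_N]%SET oo w.

Definition U (n : nat) (t : Nbar) (w : Omega) : R :=
  let i := player hN n in
  if (t < theta n w)%O then X i [set i]%SET t w else Y n w.

(* The minimum defining mu_n exists almost surely, since W_oo = U_oo almost
   surely; [Nbar_inf] is oo on the exceptional null set. *)
Definition mu (n : nat) (W : Nbar -> Omega -> \bar R) (w : Omega) : Nbar :=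
  Nbar_inf [set s | (W s w <= (U n s w)%:E + eps%:E)%E].

(* tau is a sequence (tau_n)_(n >= 1) produced by the scheme, for some choice of
   the versions of the processes W^n; tau 0 is irrelevant. *)
Definition scheme : Prop :=
  (forall n, (1 <= n <= N)%N -> forall w, tau n w = oo) /\
  (forall n, (N < n)%N ->
     exists2 W, snell_envelope P F (U n) W &
       forall w,
         let m := Order.min (mu n W w) (tau (n - N)%N w) in
         tau n w = if (m < theta n w)%O then m else tau (n - N)%N w).

Definition scheme_limit (i : 'I_N) (w : Omega) : Nbar :=
  lim ((fun q : nat => tau (N * q + i.+1)%N w) @ \oo).

End scheme.

End game.

(* Main.v *)
Require Import Defs.
From mathcomp Require Import all_boot all_order all_algebra.
From mathcomp Require Import all_classical all_reals all_analysis.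
From mathcomp Require Import measurable_realfun zify.

(* After T the payoff processes are constant, so the Snell envelope V of each
   reward U^n is given by backward induction, and the first time W^n <= U^n + eps
   is eps-optimal because V is a martingale before it meets U^n.

   Along the scheme a player changes its date only to stop strictly before all the
   others; hence at each stage either nobody stops or a single player stops first,
   and the coalition I_n is a singleton when theta_n is finite and tau_n >= theta_n.
   By Assumption (A), U^n at tau_n is then the payoff of the current profile.
   Moreover, if tau_(n-N) < theta_n, no other player has moved since stage n - N, so
   that U^n and U^(n-N) agree on this event and eps-optimality is inherited. Thus
   every stage is an eps-best response: E[U^n_S] <= E[U^n_(tau_n)] + eps.

   On each path the dates, being nonincreasing in N u {oo}, are eventually constant,
   and dominated convergence carries the inequality to the limit, where U dominates
   the payoff of a deviation and equals the payoff of the limit profile. *)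

Set Implicit Arguments.
Unset Strict Implicit.
Unset Printing Implicit Defensive.

Import Order.TTheory GRing.Theory Num.Theory.
Import numFieldNormedType.Exports.

Local Open Scope classical_set_scope.
Local Open Scope ring_scope.

(** * Conditional expectation *)

(** Two obstacles shape the proof. First, Y^n is a maximum: this makes U^n dominate every deviation
    at no cost, but at the date actually played U^n must be a payoff. Assumption (A) only compares
    {i,j} with {j}, so it resolves that maximum only when I_n is a singleton; hence the rule that a
    change of date must come strictly before theta_n. Second, the W^n are arbitrary versions, fixed
    at each date up to a null set, and U^n, U^(n-N) are different rewards that agree only on an
    event. Comparisons therefore go through V, almost surely equal to W^n at all finite dates at
    once, and through its locality: on an event of F_s where two rewards coincide at all dates,
    their V at s coincide almost surely. Random dates are handled by slicing over their countably
    many values. The date tested for optimality is tau_n /\ theta_n, not mu_n: it never exceeds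
    mu_n, and U^n is frozen from theta_n on. *)

Section sub_sigma_algebra.
Context (d : measure_display) (Omega : measurableType d) (R : realType).
Context (P : probability Omega R) (G : set (set Omega)).
Hypotheses (sG : sigma_algebra setT G) (mG : G `<=` measurable).
Implicit Types (f g h : Omega -> R) (A B : set Omega).

Lemma sub_measurableE :
  (measurable : set (set (g_sigma_algebraType G))) = G.
Proof. exact: sigma_algebra_id. Qed.

Lemma measurable_wrt_sub (d' : measure_display) (S : measurableType d')
    (g : Omega -> S) :
  measurable_wrt G g -> measurable_fun setT g.
Proof.
move=> mg _ B mB; apply: mG; have := mg measurableT B mB.
by rewrite sub_measurableE.
Qed.

Lemma measurable_wrt_preimage (d' : measure_display) (S : measurableType d')
    (g : Omega -> S) (B : set S) :
  measurable_wrt G g -> measurable B -> G (g @^-1` B).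
Proof.
by move=> mg mB; have := mg measurableT B mB; rewrite setTI sub_measurableE.
Qed.

Lemma sub_algebraC A : G A -> G (~` A).
Proof. by rewrite -sub_measurableE; exact: measurableC. Qed.

Lemma sub_algebraI A B : G A -> G B -> G (A `&` B).
Proof. by rewrite -sub_measurableE; exact: measurableI. Qed.

Lemma sub_algebraU A B : G A -> G B -> G (A `|` B).
Proof. by rewrite -sub_measurableE; exact: measurableU. Qed.

Lemma sub_algebra_cst (Q : Prop) : G [set _ | Q].
Proof.
rewrite -sub_measurableE; case: (pselect Q) => q.
  by rewrite (_ : [set _ | _] = setT)//; apply/seteqP; split.
by rewrite (_ : [set _ | _] = set0)//; apply/seteqP; split.
Qed.

Lemma sub_algebra_bigcap_fin (I : finType) (A : I -> set Omega) :
  (forall i, G (A i)) -> G (\bigcap_i A i).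
Proof.
move=> GA; rewrite -sub_measurableE; apply: fin_bigcap_measurable.
  exact: finite_finset.
by move=> i _; rewrite sub_measurableE.
Qed.

Lemma sub_algebra_bigcup (I : countType) (A : I -> set Omega) :
  (forall i, G (A i)) -> G (\bigcup_i A i).
Proof.
move=> GA; rewrite -sub_measurableE; apply: countable_bigcupT_measurable.
  exact: countableP.
by move=> i; rewrite sub_measurableE.
Qed.

(** Gluing along a countable partition in G; with C the dates, this is how processes evaluated at
    random dates are shown measurable. *)
Lemma measurable_wrt_countable (C : countType) (d' : measure_display)
    (S : measurableType d') (K : Omega -> C) (h : C -> Omega -> S) :
  (forall c, G [set w | K w = c]) -> (forall c, measurable_wrt G (h c)) ->
  measurable_wrt G (fun w => h (K w) w).
Proof.
move=> GK mh _ B mB; rewrite setTI sub_measurableE.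
have -> : (fun w => h (K w) w) @^-1` B =
    \bigcup_c ([set w | K w = c] `&` h c @^-1` B).
  apply/seteqP; split=> [w Bw|w [c _ [/= <- //]]].
  by exists (K w).
apply: sub_algebra_bigcup => c; apply: sub_algebraI => //.
exact: measurable_wrt_preimage (mh c) mB.
Qed.

(** The test set is the part of B where h < g: there the integral of g - h is at most 0 by
    hypothesis while the integrand is positive, so the set is null. Restricting to B is what later
    gives locality. *)
Lemma ae_le_sub g h B :
    measurable_wrt G g -> measurable_wrt G h ->
    P.-integrable setT (EFin \o g) -> P.-integrable setT (EFin \o h) -> G B ->
    (forall A, G A -> A `<=` B ->
      \int[P]_(w in A) g w <= \int[P]_(w in A) h w) ->
  {ae P, forall w, B w -> g w <= h w}.
Proof.
move=> mg mh ig ih GB gh.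
pose A := B `&` [set w | h w < g w].
have GA : G A.
  apply: sub_algebraI => //.
  have := @measurable_fun_ltr _ _ R setT (h : g_sigma_algebraType G -> R) g mh mg
    measurableT [set true] I.
  by rewrite setTI sub_measurableE; congr G; apply/seteqP; split.
have mA : measurable A by exact: mG.
have igA : P.-integrable A (EFin \o g) by apply: integrableS ig.
have ihA : P.-integrable A (EFin \o h) by apply: integrableS ih.
have igh : P.-integrable A (EFin \o (fun w => g w - h w)).
  by apply: (integrableB mA igA ihA).
have int0 : \int[P]_(w in A) (g w - h w) = 0.
  apply/eqP; rewrite eq_le; apply/andP; split.
    by rewrite RintegralB// subr_le0 gh// => w [].
  by apply: Rintegral_ge0 => w [_ /=]; rewrite subr_ge0 => /ltW.
have : ae_eq P A (EFin \o (fun w => g w - h w)) (cst 0%E).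
  apply/ae_eq_integral_abs => //; first exact: (measurable_int P igh).
  rewrite (eq_integral (EFin \o (fun w => g w - h w))).
    rewrite -[LHS]fineK; first by move: int0; rewrite /Rintegral /= => ->.
    exact: integrable_fin_num.
  move=> w; rewrite inE => -[_ /=]; rewrite -subr_gt0 => /ltW ?.
  by rewrite ger0_norm.
apply: filterS => w /= H Bw; rewrite leNgt; apply/negP => hg.
have [] := H (conj Bw hg) => /eqP; rewrite subr_eq0 => /eqP e.
by rewrite e ltxx in hg.
Qed.

Lemma ae_eq_sub g h B :
    measurable_wrt G g -> measurable_wrt G h ->
    P.-integrable setT (EFin \o g) -> P.-integrable setT (EFin \o h) -> G B ->
    (forall A, G A -> A `<=` B ->
      \int[P]_(w in A) g w = \int[P]_(w in A) h w) ->
  {ae P, forall w, B w -> g w = h w}.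
Proof.
move=> mg mh ig ih GB gh.
have H1 : {ae P, forall w, B w -> g w <= h w}.
  by apply: ae_le_sub => // A GA AB; rewrite gh.
have H2 : {ae P, forall w, B w -> h w <= g w}.
  by apply: ae_le_sub => // A GA AB; rewrite gh.
by apply: filterS2 H1 H2 => w h1 h2 Bw; apply/eqP; rewrite eq_le h1// h2.
Qed.

Lemma cond_exp_Rintegral f g A : cond_exp P G f g -> G A ->
  \int[P]_(w in A) g w = \int[P]_(w in A) f w.
Proof. by case=> _ _ + GA => /(_ A GA); rewrite /Rintegral => ->. Qed.

Lemma Rintegral_cond_exp f g :
    P.-integrable setT (EFin \o f) -> P.-integrable setT (EFin \o g) ->
    measurable_wrt G g ->
    (forall A, G A -> \int[P]_(w in A) g w = \int[P]_(w in A) f w) ->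
  cond_exp P G f g.
Proof.
move=> i_f ig mg fg; split=> // A GA.
have mA : measurable A by exact: mG.
rewrite -[LHS]fineK; last by apply: integrable_fin_num => //; exact: integrableS ig.
rewrite -[RHS]fineK; last by apply: integrable_fin_num => //; exact: integrableS i_f.
by congr EFin; exact: fg.
Qed.

(* The Radon-Nikodym derivative is taken on the measurable space (Omega, G),
   where P and the charge with density f become push-forwards by the identity. *)
Lemma cond_exp_exists f :
  P.-integrable setT (EFin \o f) -> exists g, cond_exp P G f g.
Proof.
move=> i_f.
pose idG : Omega -> g_sigma_algebraType G := id.
have mid : measurable_fun setT idG.
  by move=> _ B; rewrite sub_measurableE setTI => /mG.
pose idGm : {mfun Omega >-> g_sigma_algebraType G} :=
  mfun_Sub (mem_set mid).
pose mu : probability (g_sigma_algebraType G) R := distribution P idGm.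
pose nu : {charge set (g_sigma_algebraType G) -> \bar R} :=
  measure_function_pushforward__canonical__charge_Charge (induced_charge i_f) mid.
have numu : nu `<< mu.
  apply/null_content_dominatesP => A mA muA0.
  apply: null_set_integral => //; first by apply: mG; rewrite -sub_measurableE.
  by apply: measurable_funTS; exact: (measurable_int P i_f).
pose g' := Radon_Nikodym nu mu.
have fing w : g' w \is a fin_num by exact: Radon_Nikodym_fin_num.
have intg : mu.-integrable setT g' by exact: Radon_Nikodym_integrable.
have mg' : measurable_fun [set: g_sigma_algebraType G] g'.
  exact: (measurable_int mu intg).
pose g : Omega -> R := fun w => fine (g' w).
have gE : EFin \o g = g' \o idG by apply/funext => w /=; rewrite fineK.
have ig : P.-integrable setT (EFin \o g).
  rewrite gE; apply/integrableP; split; first exact: measurableT_comp.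
  move/integrableP : intg => [_]; rewrite ge0_integral_pushforward//.
  exact: measurableT_comp.
exists g; split=> //.
  by apply/measurable_EFinP; rewrite [X in measurable_fun _ X]gE.
move=> A GA; have mA : measurable (A : set (g_sigma_algebraType G)).
  by rewrite sub_measurableE.
have := Radon_Nikodym_integral numu mA.
rewrite integral_pushforward//; last first.
  by rewrite -gE; apply: integrableS ig => //; exact: mG.
by rewrite -gE => <-.
Qed.

End sub_sigma_algebra.

(** * Stopping times *)

Section Nbar_theory.
Implicit Types x y z : Nbar.

Lemma Fin_le s t : (Fin s <= Fin t)%O = (s <= t)%N. Proof. by []. Qed.

Lemma Fin_lt s t : (Fin s < Fin t)%O = (s < t)%N.
Proof. by rewrite ltNge Fin_le -ltnNge. Qed.

Lemma Fin_lt_oo s : (Fin s < oo)%O. Proof. by rewrite lt_neqAle. Qed.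

Lemma oo_le x : (oo <= x)%O -> x = oo. Proof. by case: x. Qed.

Lemma Fin_ltS s x : (Fin s < x)%O = (Fin s.+1 <= x)%O.
Proof. by case: x => [t|]; rewrite ?Fin_lt_oo //; rewrite Fin_lt. Qed.

End Nbar_theory.

(** * Integrals over events, and dominated convergence for stationary sequences *)

Section integration.
Context (d : measure_display) (Omega : measurableType d) (R : realType).
Context (P : probability Omega R).
Implicit Types (f g : Omega -> R) (A B : set Omega).

Lemma Rintegral_split f A B : measurable A -> measurable B ->
    P.-integrable setT (EFin \o f) ->
  \int[P]_(w in A) f w =
    \int[P]_(w in A `&` B) f w + \int[P]_(w in A `&` ~` B) f w.
Proof.
move=> mA mB i_f; rewrite -Rintegral_setU.
- by rewrite -setIUr setUCr setIT.
- exact: measurableI.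
- by apply: measurableI => //; exact: measurableC.
- apply: integrableS i_f => //; apply: measurableU; first exact: measurableI.
  by apply: measurableI => //; exact: measurableC.
- by rewrite disj_set2E setIACA setICr setI0.
Qed.

Lemma eq_Rintegral_on (f g : Omega -> R) A :
  (forall w, A w -> f w = g w) ->
  \int[P]_(w in A) f w = \int[P]_(w in A) g w.
Proof. by move=> fg; apply: eq_Rintegral => w; rewrite inE; exact: fg. Qed.

Lemma ae_eq_Rintegral f g A : measurable A ->
    P.-integrable setT (EFin \o f) -> P.-integrable setT (EFin \o g) ->
    {ae P, forall w, A w -> f w = g w} ->
  \int[P]_(w in A) f w = \int[P]_(w in A) g w.
Proof.
move=> mA i_f ig fg; rewrite /Rintegral; congr fine.
apply: ae_eq_integral => //.
- by apply: measurable_funTS; exact: (measurable_int P i_f).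
- by apply: measurable_funTS; exact: (measurable_int P ig).
by apply: filterS fg => w /= fg Aw; rewrite fg.
Qed.

Lemma ae_le_Rintegral f g A : measurable A ->
    P.-integrable setT (EFin \o f) -> P.-integrable setT (EFin \o g) ->
    {ae P, forall w, A w -> f w <= g w} ->
  \int[P]_(w in A) f w <= \int[P]_(w in A) g w.
Proof.
move=> mA i_f ig fg.
(* The minimum is below g everywhere and equals f almost everywhere on A, which reduces to a
   pointwise inequality. *)
have im : P.-integrable setT (EFin \o (fun w => Num.min (f w) (g w))).
  apply: (@le_integrable _ _ _ P setT measurableT _
    (fun w => (`|f w| + `|g w|)%:E)).
  - apply/measurable_EFinP; apply: measurable_minr.
      by apply/measurable_EFinP; exact: (measurable_int P i_f).
    by apply/measurable_EFinP; exact: (measurable_int P ig).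
  - move=> w _ /=; rewrite lee_fin [leRHS]ger0_norm ?addr_ge0//.
    by rewrite minElt; case: ifP => _; rewrite ?lerDl ?lerDr.
  - by apply: (integrableD measurableT (integrable_norm i_f) (integrable_norm ig)).
rewrite (@ae_eq_Rintegral f (fun w => Num.min (f w) (g w)) A) //.
  apply: le_Rintegral => //; [exact: integrableS im|exact: integrableS ig|].
  by move=> w _; rewrite ge_min lexx orbT.
by apply: filterS fg => w fg Aw; rewrite min_l// fg.
Qed.

Lemma measurable_countable (C : countType) (d' : measure_display)
    (S : measurableType d') (K : Omega -> C) (h : C -> Omega -> S) :
  (forall c, measurable [set w | K w = c]) ->
  (forall c, measurable_fun setT (h c)) ->
  measurable_fun setT (fun w => h (K w) w).
Proof.
move=> mK mh; pose G := @measurable _ Omega.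
have sG : sigma_algebra setT G by exact: sigma_algebra_measurable.
apply: (@measurable_wrt_sub _ _ G) => //.
apply: measurable_wrt_countable => // c _ B mB.
by rewrite sub_measurableE//; exact: mh.
Qed.

Lemma integrable_maxr f g :
    P.-integrable setT (EFin \o f) -> P.-integrable setT (EFin \o g) ->
  P.-integrable setT (EFin \o (fun w => Num.max (f w) (g w))).
Proof.
move=> i_f ig.
apply: (@le_integrable _ _ _ P setT measurableT _
  (fun w => (`|f w| + `|g w|)%:E)).
- apply/measurable_EFinP; apply: measurable_maxr.
    by apply/measurable_EFinP; exact: (measurable_int P i_f).
  by apply/measurable_EFinP; exact: (measurable_int P ig).
- move=> w _ /=; rewrite lee_fin [leRHS]ger0_norm ?addr_ge0//.
  by rewrite maxElt; case: ifP => _; rewrite ?lerDl ?lerDr.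
- by apply: (integrableD measurableT (integrable_norm i_f) (integrable_norm ig)).
Qed.

(** The rank q0 depends on the path, without any measurability. The limit f is only known pathwise,
    so its integrability belongs to the conclusion. *)
Lemma cvg_Rintegral_stationary (f_ : nat -> Omega -> R) f (D : Omega -> R) :
    (forall q, measurable_fun setT (f_ q)) -> P.-integrable setT (EFin \o D) ->
    (forall q w, `|f_ q w| <= D w) ->
    (forall w, exists q0, forall q, (q0 <= q)%N -> f_ q w = f w) ->
  P.-integrable setT (EFin \o f) /\
  ((fun q => \int[P]_w f_ q w) @ \oo --> \int[P]_w f w).
Proof.
move=> mf_ iD f_D f_f.
have cvgf w : setT w -> f_ ^~ w @ \oo --> f w.
  move=> _; have [q0 H] := f_f w.
  by apply: cvg_near_cst; exists q0 => // q /= ?; exact: H.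
have mf : measurable_fun setT f by exact: (measurable_fun_cvg mf_ cvgf).
have [||||| iF _ cv] := @dominated_convergence _ _ R P setT measurableT
    (fun q w => (f_ q w)%:E) (EFin \o f) (EFin \o D) => //.
- by move=> q; apply/measurable_EFinP.
- exact/measurable_EFinP.
- apply: aeW => w _; have [q0 H] := f_f w.
  by apply: cvg_near_cst; exists q0 => // q /= ?; rewrite H.
- by apply: aeW => w q _; rewrite lee_fin f_D.
split=> //; apply: fine_cvg.
rewrite fineK; last exact: integrable_fin_num.
exact: cv.
Qed.

Lemma expectation_le_add f g (eps : R) :
    P.-integrable setT (EFin \o f) -> P.-integrable setT (EFin \o g) ->
    \int[P]_w f w <= \int[P]_w g w + eps ->
  ('E_P[f] <= 'E_P[g] + eps%:E)%E.
Proof.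
move=> i_f ig fg; rewrite unlock -[leLHS]fineK; last exact: integrable_fin_num.
rewrite -[X in (_ <= X + _)%E]fineK; last exact: integrable_fin_num.
by rewrite -EFinD lee_fin.
Qed.

End integration.

Section conditional_expectation.
Context (d : measure_display) (Omega : measurableType d) (R : realType).
Context (P : probability Omega R).

(** A chosen version; the default 0 is taken only if there is none, which [condEP] rules out for
    integrable f. *)
Definition condE (G : set (set Omega)) (f : Omega -> R) : Omega -> R :=
  xget (cst 0) [set g | cond_exp P G f g].

Lemma condEP (G : set (set Omega)) (f : Omega -> R) :
    sigma_algebra setT G -> G `<=` measurable ->
    P.-integrable setT (EFin \o f) ->
  cond_exp P G f (condE G f).
Proof.
move=> sG mG i_f; have [g fg] := cond_exp_exists sG mG i_f.
exact: (@xgetI _ _ _ g).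
Qed.

End conditional_expectation.

Section stopping_times.
Context (d : measure_display) (Omega : measurableType d).
Context (F : nat -> set (set Omega)) (hF : filtration F).
Implicit Types (nu sigma : Omega -> Nbar) (A : set Omega).

Lemma filtration_sigma t : sigma_algebra setT (F t).
Proof. by case: hF. Qed.

Lemma filtration_mono s t : (s <= t)%N -> F s `<=` F t.
Proof. by case: hF => _ + _ => /(_ s t). Qed.

Lemma filtration_sub t : F t `<=` measurable.
Proof.
case: hF => _ _ -> A FA; apply: sub_sigma_algebra.
by exists t.
Qed.

Lemma Fbar_sigma t : sigma_algebra setT (Fbar F t).
Proof.
by case: t => [t|]; [exact: filtration_sigma|exact: sigma_algebra_measurable].
Qed.

Lemma Fbar_sub t : Fbar F t `<=` measurable.
Proof. by case: t => [t|//]; exact: filtration_sub. Qed.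

Lemma Fbar_mono (s t : Nbar) : (s <= t)%O -> Fbar F s `<=` Fbar F t.
Proof.
by case: t => [t|] st; [case: s st => // s; exact: filtration_mono|exact: Fbar_sub].
Qed.

Lemma stopping_time_gt_set nu t : stopping_time F nu ->
  F t [set w | (Fin t < nu w)%O].
Proof.
move=> snu; rewrite (_ : [set w | _] = ~` [set w | (nu w <= Fin t)%O]).
  by apply: sub_algebraC; [exact: filtration_sigma|exact: snu].
by apply/seteqP; split=> w /=; rewrite ltNge => /negP.
Qed.

Lemma stopping_time_eq_set nu (s t : Nbar) : stopping_time F nu -> (s <= t)%O ->
  Fbar F t [set w | nu w = s].
Proof.
move=> snu st; apply: (Fbar_mono st); case: s {st} => [[|s]|].
- rewrite (_ : [set w | _] = [set w | (nu w <= Fin 0)%O]); first exact: snu.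
  apply/seteqP; split=> w /= => [->//|].
  by case: (nu w) => [u|//]; rewrite Fin_le leqn0 => /eqP ->.
- rewrite (_ : [set w | _] =
    [set w | (nu w <= Fin s.+1)%O] `&` [set w | (Fin s < nu w)%O]).
    apply: sub_algebraI; [exact: filtration_sigma|exact: snu|].
    apply: (@filtration_mono s) => //; exact: stopping_time_gt_set.
  apply/seteqP; split=> w /=.
    by move=> ->; rewrite -/(Fin s.+1) Fin_ltS.
  by rewrite Fin_ltS => -[] h1 h2; apply/eqP; rewrite eq_le h1.
- rewrite (_ : [set w | _] = ~` \bigcup_t [set w | (nu w <= Fin t)%O]).
    apply: measurableC; apply: bigcupT_measurable => u.
    by apply: (@filtration_sub u); exact: snu.
  apply/seteqP; split=> w /=.
    by move=> nuoo [u _ /=]; rewrite nuoo.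
  by case E : (nu w) => [u|//] H; exfalso; apply: H; exists u => //=; rewrite E.
Qed.

(** The truncated date is all that is known of nu at time t: its value if already reached, the
    symbol oo otherwise. *)
Lemma stopping_time_truncated_set nu (c t : Nbar) : stopping_time F nu ->
  Fbar F t [set w | (if (nu w <= t)%O then nu w else oo) = c].
Proof.
move=> snu; case: (leP c t) => ct.
  rewrite (_ : [set w | _] = [set w | nu w = c]); first exact: stopping_time_eq_set.
  apply/seteqP; split=> w /=; last by move=> ->; rewrite ct.
  case: ifP => // /negP lt oocl; exfalso; apply: lt.
  by move: ct; rewrite -oocl => /oo_le ->; exact: Nbar_lex1.
case: t ct => [t|]; last by rewrite ltNge Nbar_lex1.
case: c => [u|] ct.
  rewrite (_ : [set w | _] = [set _ | False]).
    exact: (sub_algebra_cst (filtration_sigma t)).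
  apply/seteqP; split=> // w /=; case: ifP => // nut e.
  by move: ct; rewrite -e ltNge nut.
rewrite (_ : [set w | _] = [set w | (Fin t < nu w)%O]).
  exact: stopping_time_gt_set.
apply/seteqP; split=> w /=; rewrite ltNge; case: ifP => //.
by move=> + e; rewrite e.
Qed.

Lemma stopping_time_measurable nu t : stopping_time F nu ->
  measurable [set w | nu w = t].
Proof. by move=> snu; exact: (stopping_time_eq_set snu (Nbar_lex1 t)). Qed.

Lemma stopping_time_cst (t : Nbar) : stopping_time F (fun=> t).
Proof.
by move=> s; exact: (sub_algebra_cst (filtration_sigma s)).
Qed.

Lemma stopping_time_min nu sigma : stopping_time F nu -> stopping_time F sigma ->
  stopping_time F (fun w => Order.min (nu w) (sigma w)).
Proof.
move=> snu ssigma t.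
rewrite (_ : [set w | _] = [set w | (nu w <= Fin t)%O] `|` [set w | (sigma w <= Fin t)%O]).
  by apply: sub_algebraU; [exact: filtration_sigma|exact: snu|exact: ssigma].
by apply/seteqP; split=> w /=; rewrite ge_min => /orP.
Qed.

Lemma stopping_time_max nu sigma : stopping_time F nu -> stopping_time F sigma ->
  stopping_time F (fun w => Order.max (nu w) (sigma w)).
Proof.
move=> snu ssigma t.
rewrite (_ : [set w | _] = [set w | (nu w <= Fin t)%O] `&` [set w | (sigma w <= Fin t)%O]).
  by apply: sub_algebraI; [exact: filtration_sigma|exact: snu|exact: ssigma].
by apply/seteqP; split=> w /=; rewrite ge_max => /andP.
Qed.

End stopping_times.

(** * Snell envelopes of rewards that are constant after T *)

Section snell.
Context (d : measure_display) (Omega : measurableType d) (R : realType).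
Context (P : probability Omega R) (F : nat -> set (set Omega)).
Context (hF : filtration F) (T : nat).

Definition reward (U : Nbar -> Omega -> R) : Prop :=
  [/\ forall t, measurable_wrt (Fbar F t) (U t),
      forall t, P.-integrable setT (EFin \o U t) &
      forall t w, (Fin T <= t)%O -> U t w = U (Fin T) w].

(** Time is reversed, rank k standing for date T - k, so that backward induction is structural
    recursion. *)
Fixpoint snell_rev (U : Nbar -> Omega -> R) (k : nat) : Omega -> R :=
  if k is j.+1 then
    fun w => Num.max (U (Fin (T - k)) w) (condE P (F (T - k)%N) (snell_rev U j) w)
  else U (Fin T).

Definition snell (U : Nbar -> Omega -> R) (t : Nbar) : Omega -> R :=
  if t is Some s then snell_rev U (T - s)%N else U (Fin T).
Arguments snell : simpl never.

(** Backward induction whose base is the whole range from T to oo, where rewards are constant. *)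
Lemma horizon_ind (Q : Nbar -> Prop) :
    (forall t, (Fin T <= t)%O -> Q t) ->
    (forall s : nat, (s < T)%N -> Q (Fin s.+1) -> Q (Fin s)) ->
  forall t, Q t.
Proof.
move=> Q0 QS [s|]; last exact: Q0.
have [k] := ubnP (T - s)%N; elim: k s => // k IH s sk.
case: (leqP T s) => [Ts|sT]; first exact: Q0.
by apply: (QS s sT); apply: IH; rewrite (subnSK sT).
Qed.

Section fixed_reward.
Context (U : Nbar -> Omega -> R) (hU : reward U).
Let V := snell U.
Implicit Types (nu sigma : Omega -> Nbar) (A B : set Omega) (t : Nbar).

Lemma snell_late t w : (Fin T <= t)%O -> V t w = U t w.
Proof.
case: hU => _ _ cU Tt; rewrite (cU _ _ Tt).
by case: t Tt => [t|//]; rewrite Fin_le -subn_eq0 /V /snell => /eqP ->.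
Qed.

Lemma snellS (s : nat) w : (s < T)%N ->
  V (Fin s) w = Num.max (U (Fin s) w) (condE P (F s) (V (Fin s.+1)) w).
Proof.
move=> sT; have -> : V (Fin s) = snell_rev U (T - s.+1).+1 by rewrite subnSK.
by rewrite /= subnSK// subKn// ltnW.
Qed.

Lemma snell_data t :
  measurable_wrt (Fbar F t) (V t) /\ P.-integrable setT (EFin \o V t).
Proof.
case: hU => aU iU cU; elim/horizon_ind: t => [t Tt|s sT [mV iV]].
  by rewrite (_ : V t = U t); [split|apply/funext => w; rewrite snell_late].
have [mC iC _] := condEP (filtration_sigma hF s) (@filtration_sub _ _ _ hF s) iV.
have -> : V (Fin s) =
    fun w => Num.max (U (Fin s) w) (condE P (F s) (V (Fin s.+1)) w).
  by apply/funext => w; rewrite snellS.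
by split; [apply: measurable_maxr => //; exact: (aU (Fin s))|exact: integrable_maxr].
Qed.

Lemma snell_measurable t : measurable_wrt (Fbar F t) (V t).
Proof. by case: (snell_data t). Qed.

Lemma snell_integrable t : P.-integrable setT (EFin \o V t).
Proof. by case: (snell_data t). Qed.

Lemma condE_snellP (s : nat) :
  cond_exp P (F s) (V (Fin s.+1)) (condE P (F s) (V (Fin s.+1))).
Proof.
apply: condEP; [exact: filtration_sigma|exact: filtration_sub|].
exact: snell_integrable.
Qed.

Lemma snell_ge t w : U t w <= V t w.
Proof.
elim/horizon_ind: t => [t Tt|s sT _]; first by rewrite snell_late.
by rewrite snellS// le_max lexx.
Qed.

Lemma snell_cst t w : (Fin T <= t)%O -> V t w = V (Fin T) w.
Proof. by case: hU => _ _ cU Tt; rewrite !snell_late// cU. Qed.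

(** Along a path Z only takes its values at 0, ..., T, so a finite sum of absolute values dominates
    it for every nu. *)
Lemma integrable_stopped (Z : Nbar -> Omega -> R) nu :
    (forall t, P.-integrable setT (EFin \o Z t)) ->
    (forall t w, (Fin T <= t)%O -> Z t w = Z (Fin T) w) -> stopping_time F nu ->
  P.-integrable setT (EFin \o (fun w => Z (nu w) w)).
Proof.
move=> iZ cZ snu.
apply: (@le_integrable _ _ _ P setT measurableT _
  (fun w => \sum_(s < T.+1) (`|Z (Fin s) w|)%:E)%E).
- apply/measurable_EFinP.
  apply: (@measurable_countable _ _ (option nat) _ _ nu Z) => t.
    exact: (stopping_time_measurable hF).
  by apply/measurable_EFinP; exact: (measurable_int P (iZ t)).
- move=> w _ /=; rewrite sumEFin /= lee_fin [leRHS]ger0_norm ?sumr_ge0//.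
  have bound (s : 'I_T.+1) : `|Z (Fin s) w| <= \sum_(s < T.+1) `|Z (Fin s) w|.
    by rewrite (bigD1 s)//= lerDl sumr_ge0.
  case: (leP (nu w) (Fin T)) => nuT.
    case: (nu w) nuT => [s|//]; rewrite Fin_le -ltnS => sT.
    exact: (bound (Ordinal sT)).
  by rewrite (cZ _ _ (ltW nuT)); exact: (bound ord_max).
- by apply: integrable_sum => // s _; exact: integrable_norm.
Qed.

Lemma integrable_reward nu : stopping_time F nu ->
  P.-integrable setT (EFin \o (fun w => U (nu w) w)).
Proof. by case: hU => _ iU cU; exact: integrable_stopped. Qed.

Lemma integrable_snell nu : stopping_time F nu ->
  P.-integrable setT (EFin \o (fun w => V (nu w) w)).
Proof.
by apply: integrable_stopped; [exact: snell_integrable|exact: snell_cst].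
Qed.

(** Integral form of E[U_nu | F_t] <= V_t: quantifying over A in F_t lets [ae_le_sub] recover the
    almost sure inequality. *)
Lemma le_Rintegral_snell t nu A :
    stopping_time F nu -> (forall w, (t <= nu w)%O) -> Fbar F t A ->
  \int[P]_(w in A) U (nu w) w <= \int[P]_(w in A) V t w.
Proof.
elim/horizon_ind: t nu A => [t Tt nu A snu tnu FA|s sT IH nu A snu snuw FA].
  rewrite le_eqVlt; apply/orP; left; apply/eqP.
  apply: eq_Rintegral_on => w _; rewrite snell_late//.
  by case: hU => _ _ cU; rewrite cU ?(le_trans Tt)// [RHS]cU.
have mA : measurable A by exact: (filtration_sub hF FA).
have FB := stopping_time_gt_set hF s snu.
set B := (X in F s X) in FB.
have mB : measurable B by exact: (filtration_sub hF FB).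
have sF := filtration_sigma hF s.
have FAB : F s (A `&` B) by exact: (sub_algebraI sF).
have FAC : F s (A `&` ~` B) by apply: (sub_algebraI sF) => //; exact: (sub_algebraC sF).
have mAB : measurable (A `&` B) by exact: (filtration_sub hF FAB).
have mAC : measurable (A `&` ~` B) by exact: (filtration_sub hF FAC).
have iU := integrable_reward snu.
have iV := snell_integrable (Fin s).
rewrite (Rintegral_split mA mB iU) (Rintegral_split mA mB iV); apply: lerD.
  (* The induction hypothesis wants a date at least s + 1 on every path; the maximum changes nu only
     off B. *)
  pose nu' w := Order.max (nu w) (Fin s.+1).
  have snu' : stopping_time F nu'.
    by apply: (stopping_time_max hF) => //; exact: (stopping_time_cst hF).
  have -> : \int[P]_(w in A `&` B) U (nu w) w = \int[P]_(w in A `&` B) U (nu' w) w.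
    by apply: eq_Rintegral_on => w [_]; rewrite /B /= Fin_ltS /nu' => /max_l ->.
  apply: (le_trans (IH nu' _ snu' _ _)).
  - by move=> w; rewrite /nu' le_max lexx orbT.
  - exact: (filtration_mono hF (leqnSn s)).
  rewrite -(cond_exp_Rintegral (condE_snellP s) FAB).
  apply: le_Rintegral => //.
  - by apply: integrableS (_ : P.-integrable setT _) => //; case: (condE_snellP s).
  - by apply: integrableS iV.
  - by move=> w _; rewrite snellS// le_max lexx orbT.
apply: le_Rintegral => //; [exact: integrableS iU|exact: integrableS iV|].
move=> w [_]; rewrite /B /= => nB; rewrite (_ : nu w = Fin s); first exact: snell_ge.
by apply/eqP; rewrite eq_le snuw andbT leNgt; apply/negP.
Qed.

(** The date is built backwards: stop at s if V meets U there, otherwise follow the date built for s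
    + 1. On U < V the maximum defining V is the conditional expectation, so no mass is lost. *)
Lemma snell_optimal t : exists nu,
  [/\ stopping_time F nu, forall w, (t <= nu w)%O &
    forall A, Fbar F t A ->
      \int[P]_(w in A) U (nu w) w = \int[P]_(w in A) V t w].
Proof.
elim/horizon_ind: t => [t Tt|s sT [nu [snu nuS opt]]].
  exists (fun=> t); split=> //; first exact: (stopping_time_cst hF).
  by move=> A _; apply: eq_Rintegral_on => w _; rewrite snell_late.
have sF := filtration_sigma hF s.
pose B := [set w | U (Fin s) w < V (Fin s) w].
have FB : F s B.
  have := @measurable_fun_ltr _ _ R setT
    (U (Fin s) : g_sigma_algebraType (F s) -> R) (V (Fin s)) _ _
    measurableT [set true] I.
  rewrite setTI (sub_measurableE sF); apply.
    by case: hU => aU _ _; exact: (aU (Fin s)).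
  exact: (@snell_measurable (Fin s)).
have mB : measurable B by exact: (filtration_sub hF FB).
pose nu' w := if U (Fin s) w < V (Fin s) w then nu w else Fin s.
have snu' : stopping_time F nu'.
  move=> u; have sFu := filtration_sigma hF u; case: (leqP s u) => su; last first.
    rewrite (_ : [set w | _] = set0).
      by rewrite -(sub_measurableE sFu); exact: measurable0.
    apply/seteqP; split=> // w; rewrite /= /nu'; case: ifP => _.
      move=> /(le_trans (nuS w)); rewrite Fin_le => /(ltn_trans su).
      by rewrite ltnn.
    by rewrite Fin_le leqNgt su.
  rewrite (_ : [set w | _] = (B `&` [set w | (nu w <= Fin u)%O]) `|` ~` B).
    apply: (sub_algebraU sFu).
      by apply: (sub_algebraI sFu); [exact: (filtration_mono hF su)|exact: snu].
    by apply: (sub_algebraC sFu); exact: (filtration_mono hF su).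
  apply/seteqP; split=> w; rewrite /= /nu' /B /=; case: ifPn => sV //.
  - by left.
  - by right.
  - by case=> // -[].
exists nu'; split=> //.
  by move=> w; rewrite /nu'; case: ifP => _ //; apply: le_trans (nuS w); rewrite Fin_le.
move=> A FA.
have mA : measurable A by exact: (filtration_sub hF FA).
have FAB : F s (A `&` B) by exact: (sub_algebraI sF).
rewrite (Rintegral_split mA mB (integrable_reward snu')).
rewrite (Rintegral_split mA mB (snell_integrable (Fin s))); congr (_ + _).
  transitivity (\int[P]_(w in A `&` B) U (nu w) w).
    by apply: eq_Rintegral_on => w [_ /=]; rewrite /nu' => ->.
  rewrite opt; last exact: (filtration_mono hF (leqnSn s)).
  rewrite -(cond_exp_Rintegral (condE_snellP s) FAB).
  apply: eq_Rintegral_on => w [_]; rewrite /B /= snellS// lt_max ltxx/=.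
  by move=> /ltW /max_r ->.
apply: eq_Rintegral_on => w [_]; rewrite /B /nu' /= => /negP nB.
rewrite (negbTE nB); apply/eqP; rewrite eq_le snell_ge/=.
by rewrite leNgt.
Qed.

(** Minimality is immediate because the supremum is attained: V_t is itself a member of the
    family. *)
Lemma snell_is_envelope : snell_envelope P F U (fun t w => (V t w)%:E).
Proof.
move=> t; have mV := @snell_measurable t; have iV := snell_integrable t.
have sF := Fbar_sigma hF t; have FO := @Fbar_sub _ _ _ hF t.
split; first by apply/measurable_EFinP.
split.
- exact: (measurable_int P iV).
- move=> _ [g [nu [snu tnu hg]] <-].
  have [mg ig _] := hg.
  have : {ae P, forall w, setT w -> g w <= V t w}.
    apply: (ae_le_sub sF FO) => //.
      by rewrite -(sub_measurableE sF); exact: measurableT.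
    move=> A FA _; rewrite (cond_exp_Rintegral hg FA).
    exact: le_Rintegral_snell.
  by apply: filterS => w H /=; rewrite lee_fin; exact: H.
- move=> Z' mZ'; apply; exists (V t) => //=.
  have [nu [snu tnu opt]] := snell_optimal t.
  exists nu; split=> //; apply: (Rintegral_cond_exp FO) => //.
    exact: integrable_reward.
  by move=> A FA; rewrite opt.
Qed.

(** Two essential suprema of one family bound each other. The null set depends on t, which
    countability of the dates will absorb. *)
Lemma snell_envelope_unique W : snell_envelope P F U W ->
  forall t, {ae P, forall w, W t w = (V t w)%:E}.
Proof.
move=> hW t; have [_ [mW W1 W2]] := hW t.
have [_ [mV V1 V2]] := snell_is_envelope t.
apply: filterS2 (W2 _ mV V1) (V2 _ mW W1) => w h1 h2.
by apply/eqP; rewrite eq_le h1.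
Qed.

(** On B an optimal date after t still collects U_t, so V_t and U_t have equal integrals over the
    events of F_t inside B. *)
Lemma snell_absorbed t B : Fbar F t B ->
    (forall w s, B w -> (t <= s)%O -> U s w = U t w) ->
  {ae P, forall w, B w -> V t w = U t w}.
Proof.
move=> FB UB; have [aU iU _] := hU; have [nu [_ tnu opt]] := snell_optimal t.
apply: (ae_eq_sub (Fbar_sigma hF t) (@Fbar_sub _ _ _ hF t) (@snell_measurable t)
  (aU t) (snell_integrable t) (iU t) FB) => A FA AB.
by rewrite -opt//; apply: eq_Rintegral_on => w /AB Bw; exact: UB.
Qed.

(* As long as V > U, V is the conditional expectation of its next value, so that
   stopping it no later than its first contact with U preserves the mean. *)
Lemma Rintegral_snell_stopped sigma : stopping_time F sigma ->
    {ae P, forall w (s : nat), (s < T)%N -> (Fin s < sigma w)%O ->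
      U (Fin s) w < V (Fin s) w} ->
  \int[P]_w V (sigma w) w = \int[P]_w V (Fin 0) w.
Proof.
move=> ssigma H.
(* Induction on a cap s put on sigma; at s = T the cap is harmless since V is constant from T on. *)
suff Q s : (s <= T)%N ->
    \int[P]_w V (Order.min (sigma w) (Fin s)) w = \int[P]_w V (Fin 0) w.
  rewrite -(Q T)//; apply: eq_Rintegral_on => w _.
  by case: leP => // /ltW Ts; rewrite snell_cst.
elim: s => [_|s IH sT].
  apply: eq_Rintegral_on => w _.
  by case: leP => //; case: (sigma w) => // u; rewrite Fin_le leqn0 => /eqP ->.
rewrite -(IH (ltnW sT)).
have FB := stopping_time_gt_set hF s ssigma.
set B := (X in F s X) in FB.
have mB : measurable B by exact: (filtration_sub hF FB).
have smin u : stopping_time F (fun w => Order.min (sigma w) (Fin u)).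
  by apply: (stopping_time_min hF) => //; exact: (stopping_time_cst hF).
rewrite (Rintegral_split measurableT mB (integrable_snell (smin s.+1))).
rewrite (Rintegral_split measurableT mB (integrable_snell (smin s))).
congr (_ + _); last first.
  apply: eq_Rintegral_on => w [_]; rewrite /B /= => /negP; rewrite -leNgt => sl.
  by rewrite !min_l// (le_trans sl)// Fin_le.
rewrite !setTI.
transitivity (\int[P]_(w in B) V (Fin s.+1) w).
  by apply: eq_Rintegral_on => w; rewrite /B /= Fin_ltS => /min_r ->.
rewrite -(cond_exp_Rintegral (condE_snellP s) FB).
transitivity (\int[P]_(w in B) V (Fin s) w).
  apply: ae_eq_Rintegral => //.
  - by case: (condE_snellP s).
  - exact: snell_integrable.
  apply: filterS H => w /(_ s sT) H Bw; have := H Bw.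
  by rewrite snellS// lt_max ltxx/= => /ltW /max_r ->.
by apply: eq_Rintegral_on => w; rewrite /B /= => /ltW /min_r ->.
Qed.

(** In expectation, U_nu <= V_0 = V_sigma <= U_sigma + eps. *)
Lemma eps_optimal (eps : R) sigma nu :
    stopping_time F sigma -> stopping_time F nu ->
    {ae P, forall w (s : nat), (s < T)%N -> (Fin s < sigma w)%O ->
      U (Fin s) w < V (Fin s) w} ->
    {ae P, forall w, V (sigma w) w <= U (sigma w) w + eps} ->
  \int[P]_w U (nu w) w <= \int[P]_w U (sigma w) w + eps.
Proof.
move=> ssigma snu H1 H2.
have i_eps : P.-integrable setT (EFin \o (fun=> eps : R)).
  exact: finite_measure_integrable_cst.
have -> : \int[P]_w U (sigma w) w + eps = \int[P]_w (U (sigma w) w + eps).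
  rewrite RintegralD//; last exact: integrable_reward.
  by rewrite Rintegral_cst// [X in fine X]probability_setT mulr1.
apply: (@le_trans _ _ (\int[P]_w V (Fin 0) w)).
  apply: le_Rintegral_snell => //.
    by move=> w; case: (nu w).
  by rewrite -(sub_measurableE (Fbar_sigma hF (Fin 0))); exact: measurableT.
rewrite -(Rintegral_snell_stopped ssigma H1).
apply: ae_le_Rintegral => //; first exact: integrable_snell.
  exact: (integrableD measurableT (integrable_reward ssigma) i_eps).
by apply: filterS H2 => w ? _.
Qed.

End fixed_reward.

(** B stays in the later sigma-algebras, so no conditional expectation in the backward induction
    mixes B with its complement. *)
Lemma snell_local U U' t B : reward U -> reward U' -> Fbar F t B ->
    (forall w s, B w -> U s w = U' s w) ->
  {ae P, forall w, B w -> snell U t w = snell U' t w}.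
Proof.
move=> hU hU' + UU'; elim/horizon_ind: t => [t Tt FB|s sT IH FB].
  apply: aeW => w Bw; rewrite !snell_late//; exact: UU'.
have IHB := IH (filtration_mono hF (leqnSn s) FB).
have gen g1 g2 : cond_exp P (F s) (snell U (Fin s.+1)) g1 ->
    cond_exp P (F s) (snell U' (Fin s.+1)) g2 ->
    {ae P, forall w, B w -> g1 w = g2 w}.
  move=> c1 c2; have [m1 i1 _] := c1; have [m2 i2 _] := c2.
  apply: (ae_eq_sub (filtration_sigma hF s) (@filtration_sub _ _ _ hF s)
    m1 m2 i1 i2 FB) => A FA AB.
  rewrite (cond_exp_Rintegral c1 FA) (cond_exp_Rintegral c2 FA).
  apply: ae_eq_Rintegral; [|exact: snell_integrable|exact: snell_integrable|].
    exact: (filtration_sub hF FA).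
  by apply: filterS IHB => w H /AB.
have := gen _ _ (condE_snellP hU s) (condE_snellP hU' s).
by apply: filterS => w H Bw; rewrite !snellS// H// UU'.
Qed.

End snell.

(** * Paths of the scheme *)

Lemma bigmin_geP (I : eqType) (r : seq I) (x : I -> Nbar) (c : Nbar) :
  (c <= \big[Order.min/oo]_(i <- r) x i)%O <->
  forall i, i \in r -> (c <= x i)%O.
Proof.
elim: r => [|a r IH]; first by rewrite big_nil Nbar_lex1.
rewrite big_cons le_min; split=> [/andP[ca /IH H] i|H].
  by rewrite in_cons => /predU1P[->//|]; exact: H.
rewrite H ?mem_head//=; apply/IH => i ir.
by apply: H; rewrite in_cons ir orbT.
Qed.

Lemma bigmin_attained (I : eqType) (r : seq I) (x : I -> Nbar) : r != [::] ->
  exists2 i, i \in r & x i = \big[Order.min/oo]_(i <- r) x i.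
Proof.
elim: r => // a [|b r] IH _.
  exists a; first by rewrite mem_head.
  by rewrite big_cons big_nil min_l ?Nbar_lex1.
rewrite big_cons; case: leP => _; first by exists a; rewrite ?mem_head.
have [//|j jr E] := IH; exists j => //.
by rewrite in_cons jr orbT.
Qed.

Section scheme_paths.
Context (d : measure_display) (Omega : measurableType d) (N : nat) (hN : (1 < N)%N).
Context (tau : nat -> Omega -> Nbar).
Local Notation theta := (theta N tau).
Local Notation stoppers := (stoppers hN tau).
Local Notation player := (player hN).

Lemma theta_geP n w c :
  (c <= theta n w)%O <-> forall l, (n - N + 1 <= l < n)%N -> (c <= tau l w)%O.
Proof.
rewrite /theta; split=> [/bigmin_geP H l ln|H].
  by apply: H; rewrite mem_index_iota.
by apply/bigmin_geP => l; rewrite mem_index_iota; exact: H.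
Qed.

Lemma theta_le n w l : (n - N + 1 <= l < n)%N -> (theta n w <= tau l w)%O.
Proof. by move: l; apply/theta_geP. Qed.

Lemma theta_attained n w : (N < n)%N ->
  exists2 l, (n - N + 1 <= l < n)%N & tau l w = theta n w.
Proof.
move=> Nn; have [|l lr E] :=
    @bigmin_attained _ (index_iota (n - N + 1) n) (fun l => tau l w).
  by rewrite -size_eq0 size_iota; lia.
by exists l => //; rewrite -mem_index_iota.
Qed.

Lemma val_player n : val (player n) = (n.-1 %% N)%N. Proof. by []. Qed.

Lemma player_neq n l : (N < n)%N -> (n - N + 1 <= l < n)%N ->
  player l != player n.
Proof.
move=> Nn ln; rewrite -val_eqE !val_player eq_sym eqn_mod_dvd; last by lia.
by apply/negP => /dvdn_leq; lia.
Qed.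

Lemma player_index (q : nat) (i : 'I_N) : player (N * q + i.+1) = i.
Proof.
apply/val_inj; rewrite val_player addnS /= mulnC modnMDl modn_small//.
Qed.

Lemma index_player n : (0 < n)%N -> n = (N * (n.-1 %/ N) + (player n).+1)%N.
Proof. by move=> n0; rewrite val_player mulnC addnS -divn_eq prednK. Qed.

Lemma player_subN n : (N < n)%N -> player (n - N) = player n.
Proof.
move=> Nn; apply/val_inj; rewrite !val_player.
by rewrite -[in RHS](subnK (ltnW Nn)) -subn1 -(subn1 (_ + _)) -addnBAC ?subn_gt0// modnDr.
Qed.

(** Write n = Nq + r + 1 with r < N. A player j < r last acted in the current round q, a player j >
    r in round q - 1, which exists because n > N. *)
Lemma player_surj n j : (N < n)%N -> j != player n ->
  exists2 l, (n - N + 1 <= l < n)%N & player l = j.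
Proof.
move=> Nn; rewrite -val_eqE val_player => jn.
have rN : (n.-1 %% N < N)%N by rewrite ltn_mod ltnW.
have nE : n = (N * (n.-1 %/ N) + (n.-1 %% N).+1)%N by apply: index_player; lia.
have q0 : (0 < n.-1 %/ N)%N by rewrite divn_gt0 ?(ltnW hN)//; lia.
move: rN nE q0 jn; set r := (n.-1 %% N)%N; set q := (n.-1 %/ N)%N => rN nE q0 jn.
have jN := ltn_ord j.
case: (ltngtP j r) jn => // jr _.
  by exists (N * q + j.+1)%N; [lia|exact: player_index].
exists (N * q.-1 + j.+1)%N; last exact: player_index.
by case: q q0 nE => // q _ /= nE; rewrite mulnS in nE; lia.
Qed.

Lemma stoppersP n w j : (N < n)%N ->
  reflect (exists l, [/\ (n - N + 1 <= l < n)%N, player l = j & tau l w = theta n w])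
    (j \in stoppers n w).
Proof.
move=> Nn; apply: (iffP imsetP).
  move=> [l]; rewrite inE => /andP[ln /eqP tl] ->.
  by exists l; rewrite ln ltn_ord tl.
move=> [l [/andP[ln1 ln2] <- tl]]; exists (Ordinal ln2) => //.
by rewrite inE /= ln1 tl eqxx.
Qed.

Lemma stoppers_neq0 n w : (N < n)%N -> stoppers n w != finset.set0.
Proof.
move=> Nn; have [l ln E] := theta_attained w Nn.
apply/set0Pn; exists (player l); apply/stoppersP => //.
by exists l.
Qed.

Section one_path.
Variable w : Omega.
Hypotheses (tau_init : forall n, (1 <= n <= N)%N -> tau n w = oo)
  (tau_mono : forall n, (N < n)%N -> (tau n w <= tau (n - N) w)%O)
  (tau_step : forall n, (N < n)%N ->
    tau n w = tau (n - N)%N w \/ (tau n w < theta n w)%O).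

(* A player changes date only to stop strictly before all the others, and thereby
   becomes the unique first one to stop. *)
Lemma unique_first n : (N <= n)%N ->
  (forall l, (n - N + 1 <= l <= n)%N -> tau l w = oo) \/
  exists2 l0, (n - N + 1 <= l0 <= n)%N &
    forall l, (n - N + 1 <= l <= n)%N -> l != l0 -> (tau l0 w < tau l w)%O.
Proof.
elim: n => [|n IH]; first by lia.
rewrite leq_eqVlt => /predU1P[<-|Nn].
  by left=> l ln; apply: tau_init; lia.
case: (tau_step Nn) => [e|lt]; last first.
  right; exists n.+1; first by lia.
  by move=> l ln lneq; apply: (lt_le_trans lt); apply: theta_le; lia.
case: (IH ltac:(lia)) => [alloo|[l0 l0n l0P]].
  left=> l ln; case: (eqVneq l n.+1) => [->|lneq]; last by apply: alloo; lia.
  by rewrite e; apply: alloo; lia.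
(* The window drops the index n + 1 - N. If that was the first stopper, n + 1, which keeps its date,
   takes its place. *)
right; case: (eqVneq l0 (n.+1 - N)%N) => [l0E|l0E].
  exists n.+1; first by lia.
  by move=> l ln lneq; rewrite e -l0E; apply: l0P; lia.
exists l0; first by lia.
move=> l ln lneq; case: (eqVneq l n.+1) => [->|lneq']; last by apply: l0P => //; lia.
by rewrite e; apply: l0P; [lia|rewrite eq_sym].
Qed.

(* A change at a stage l in between would give tau l < theta l <= tau (n - N). *)
Lemma no_change n : (N < n)%N -> (tau (n - N) w < theta n w)%O ->
  (N < n - N)%N /\ forall l, (n - N < l < n)%N -> tau l w = tau (l - N) w.
Proof.
move=> Nn tlt.
have nN : (N < n - N)%N.
  rewrite ltnNge; apply/negP => nN.
  by move: tlt; rewrite tau_init ?ltNge ?Nbar_lex1//; lia.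
split=> // l ln; case: (@tau_step l) => [|//|lt]; first by lia.
have : (tau l w < tau (n - N) w)%O.
  by apply: (lt_le_trans lt); apply: theta_le; lia.
move/lt_trans => /(_ _ tlt); rewrite ltNge => /negP[].
by apply: theta_le; lia.
Qed.

(** The shift by N matches the two windows, and by [no_change] it preserves every date in them. *)
Lemma theta_no_change n : (N < n)%N -> (tau (n - N) w < theta n w)%O ->
  theta n w = theta (n - N) w.
Proof.
move=> Nn tlt; have [nN same] := no_change Nn tlt.
apply/eqP; rewrite eq_le; apply/andP; split; apply/theta_geP => l ln.
  rewrite (_ : l = l + N - N)%N; last by lia.
  by rewrite -same; [apply: theta_le|]; lia.
by rewrite same; [apply: theta_le|]; lia.
Qed.

Lemma stoppers_no_change n : (N < n)%N -> (tau (n - N) w < theta n w)%O ->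
  stoppers n w = stoppers (n - N) w.
Proof.
move=> Nn tlt; have [nN same] := no_change Nn tlt.
apply/setP => j; apply/(stoppersP _ _ Nn)/(stoppersP _ _ nN).
  move=> [l [ln lj tl]]; exists (l - N)%N.
  split; [lia|by rewrite player_subN//; lia|].
  by rewrite -same; [rewrite -theta_no_change|lia].
move=> [l [ln lj tl]]; exists (l + N)%N.
split; [lia| |by rewrite same; [rewrite addnK tl -theta_no_change|lia]].
by rewrite -(@player_subN (l + N)) ?addnK//; lia.
Qed.

Lemma U_no_change (R : realType) (X : 'I_N -> {set 'I_N} -> Nbar -> Omega -> R) n t :
    (N < n)%N -> (tau (n - N) w < theta n w)%O ->
  U hN X tau n t w = U hN X tau (n - N) t w.
Proof.
move=> Nn tlt; rewrite /U /Y.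
by rewrite theta_no_change// stoppers_no_change// player_subN.
Qed.

End one_path.
End scheme_paths.

(** * Limits of the dates along a path *)

Lemma locally_compact_nat : locally_compact [set: nat].
Proof.
move=> x _; exists [set x]; first rewrite withinET.
  by apply: open_nbhs_nbhs; split=> //; exact: discrete_open.
by split; [exact: compact_set1|exact: discrete_closed].
Qed.

Lemma Nbar_hausdorff : hausdorff_space Nbar.
Proof.
apply: one_point_compactification_hausdorff; first exact: locally_compact_nat.
exact: discrete_hausdorff.
Qed.

(** Either u is oo forever, or it reaches some finite m and can then drop at most m times. *)
Lemma Nbar_nonincreasing_stationary (u : nat -> Nbar) :
    (forall q, (u q.+1 <= u q)%O) ->
  exists q0, forall q, (q0 <= q)%N -> u q = u q0.
Proof.
move=> umono; have um a b : (a <= b)%N -> (u b <= u a)%O.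
  move=> /subnKC <-; elim: (b - a)%N => [|k IH]; first by rewrite addn0.
  by rewrite addnS; apply: le_trans (umono _) IH.
have fin m : forall q, u q = Fin m ->
    exists q0, forall q, (q0 <= q)%N -> u q = u q0.
  have [k] := ubnP m; elim: k m => // k IH m mk q uq.
  case: (pselect (forall q', (q <= q')%N -> u q' = u q)) => [H|]; first by exists q.
  move=> /existsNP[q' /not_implyP[qq' neq]].
  have := um _ _ qq'; rewrite uq; case E : (u q') => [m'|//].
  rewrite Fin_le leq_eqVlt => /predU1P[m'm|m'm].
    by case: neq; rewrite E uq m'm.
  by apply: (IH m' _ q') => //; apply: leq_trans m'm _.
case: (pselect (forall q, u q = oo)) => [H|/existsNP[q]].
  by exists 0%N => q _; rewrite !H.
by case E : (u q) => [m|//] _; exact: fin E.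
Qed.

Section limit_of_path.
Context (d : measure_display) (Omega : measurableType d) (N : nat) (hN : (1 < N)%N).
Context (tau : nat -> Omega -> Nbar) (w : Omega).
Hypothesis tau_mono : forall n, (N < n)%N -> (tau n w <= tau (n - N) w)%O.

Lemma tau_index_mono (i : 'I_N) q :
  (tau (N * q.+1 + i.+1)%N w <= tau (N * q + i.+1)%N w)%O.
Proof.
have := @tau_mono (N * q.+1 + i.+1)%N.
by rewrite mulnS -addnA addKn; apply; lia.
Qed.

Lemma scheme_limit_stationary (i : 'I_N) : exists q0, forall q, (q0 <= q)%N ->
  tau (N * q + i.+1)%N w = scheme_limit tau i w.
Proof.
have [q0 H] := Nbar_nonincreasing_stationary (tau_index_mono i).
exists q0 => q qq0; rewrite (H q qq0) /scheme_limit; apply/esym.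
apply: (cvg_lim Nbar_hausdorff).
by apply: cvg_near_cst; exists q0 => // k /= ?; exact: H.
Qed.

Lemma scheme_limit_cvg (i : 'I_N) :
  (fun q : nat => tau (N * q + i.+1)%N w) @ \oo --> scheme_limit tau i w.
Proof.
have [q0 H] := scheme_limit_stationary i.
by apply: cvg_near_cst; exists q0 => // k /= ?; exact: H.
Qed.

Lemma scheme_limit_le (i : 'I_N) q :
  (scheme_limit tau i w <= tau (N * q + i.+1)%N w)%O.
Proof.
have [q0 H] := scheme_limit_stationary i.
rewrite -(H (q0 + q)%N) ?leq_addr//; elim: q0 {H} => // q0 IH.
by rewrite addSn; apply: le_trans (tau_index_mono i _) IH.
Qed.

Lemma scheme_stable : exists L, forall l, (L <= l)%N ->
  tau l w = scheme_limit tau (player hN l) w.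
Proof.
have [q0 H] := choice scheme_limit_stationary.
have [m mP] : exists m, forall i, (q0 i <= m)%N.
  by exists (\max_(i < N) q0 i) => i; exact: (leq_bigmax i).
(* From this index on, the round (l - 1) / N is at least m, hence past the rank of every player. *)
exists (N * m.+1)%N => l Ll.
rewrite [in LHS](@index_player N hN l); last by lia.
apply: H; apply: (leq_trans (mP _)).
by rewrite leq_divRL ?(ltnW hN)//; move: Ll; rewrite mulnS mulnC; lia.
Qed.

End limit_of_path.

(** * The payoff of a profile compared with the reward of a stage *)

Section payoffs.
Context (d : measure_display) (Omega : measurableType d) (R : realType).
Context (N : nat) (hN : (1 < N)%N).
Context (X : 'I_N -> {set 'I_N} -> Nbar -> Omega -> R).
Implicit Types (S : 'I_N -> Omega -> Nbar) (w : Omega).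

Lemma first_stop_geP S w c :
  (c <= first_stop S w)%O <-> forall j, (c <= S j w)%O.
Proof.
rewrite /first_stop bigmin_geP; split=> H j; last by [].
by apply: H; rewrite mem_index_enum.
Qed.

Lemma first_stop_le S w j : (first_stop S w <= S j w)%O.
Proof. by move: j; apply/first_stop_geP. Qed.

Lemma first_stop_attained S w : exists j, S j w = first_stop S w.
Proof.
have [|j _ E] := @bigmin_attained _ (index_enum 'I_N) (fun j => S j w).
  apply/eqP => E; have := mem_index_enum (Ordinal (ltnW hN)).
  by rewrite E.
by exists j.
Qed.

(** The events indexing the sum are disjoint, and the one containing w belongs to the coalition of
    first stoppers, nonempty because the minimum is attained. *)
Lemma payoffE i S w :
  payoff X i S w =
    X i [set j | S j w == first_stop S w]%SET (first_stop S w) w.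
Proof.
set A := [set j | _]%SET.
have A0 : A != finset.set0.
  have [j E] := first_stop_attained S w.
  by apply/set0Pn; exists j; rewrite inE E.
rewrite /payoff (bigD1 A)//= [X in _ + X]big1 ?addr0.
  rewrite indicE mem_set ?mulr1//; split=> j; rewrite inE; first by move/eqP.
  by move=> ne; rewrite lt_neqAle eq_sym ne first_stop_le.
move=> I /andP[_ IA]; rewrite indicE memNset ?mulr0// => -[HI HIc].
move/eqP: IA; apply; apply/setP => j; rewrite inE.
case: (boolP (j \in I)) => jI; first by rewrite HI ?eqxx.
by have := HIc j jI; rewrite lt_neqAle eq_sym => /andP[/negbTE ->].
Qed.

Section one_stage.
Context (tau : nat -> Omega -> Nbar) (n : nat) (Nn : (N < n)%N).
Local Notation i := (player hN n).
Context (S : 'I_N -> Omega -> Nbar) (w : Omega).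
Hypothesis S_tau : forall l, (n - N + 1 <= l < n)%N ->
  S (player hN l) w = tau l w.

Lemma theta_le_others j : j != i -> (theta N tau n w <= S j w)%O.
Proof.
by move=> /(player_surj Nn)[l ln <-]; rewrite S_tau//; exact: theta_le.
Qed.

Lemma theta_others :
  theta N tau n w = \big[Order.min/oo]_(j < N | j != i) S j w.
Proof.
apply/eqP; rewrite eq_le; apply/andP; split.
  by apply: le_bigmin => [|j ji]; [exact: Nbar_lex1|exact: theta_le_others].
apply/theta_geP => l ln; rewrite -S_tau//; apply: bigmin_le_cond.
exact: player_neq.
Qed.

Lemma first_stopE : first_stop S w = Order.min (S i w) (theta N tau n w).
Proof.
apply/eqP; rewrite eq_le; apply/andP; split.
  rewrite le_min first_stop_le/=.
  by apply/theta_geP => l ln; rewrite -S_tau//; exact: first_stop_le.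
apply/first_stop_geP => j; rewrite ge_min.
by case: (eqVneq j i) => [->|/theta_le_others ->]; rewrite ?lexx// orbT.
Qed.

Lemma stoppersE :
  stoppers hN tau n w = [set j | (j != i) && (S j w == theta N tau n w)]%SET.
Proof.
apply/setP => j; rewrite inE; apply/(stoppersP _ _ _ _ Nn)/andP.
  move=> [l [ln <- tl]]; split; first exact: player_neq.
  by rewrite S_tau// tl.
move=> [ji /eqP Sj]; have [l ln lj] := player_surj Nn ji.
by exists l; rewrite -S_tau// lj.
Qed.

(** Gives the payoff the shape of [U]. They can differ only if theta is finite and player i does not
    stop before it, and there the payoff is one of the two terms of the maximum in [Y]. *)
Lemma payoff_stage :
  payoff X i S w =
  if (S i w < theta N tau n w)%O then X i [set i]%SET (S i w) w
  else if theta N tau n w == oo then X i [set: 'I_N]%SET oo w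
  else X i (if S i w == theta N tau n w then (stoppers hN tau n w :|: [set i])%SET
            else stoppers hN tau n w) (theta N tau n w) w.
Proof.
rewrite payoffE first_stopE; case: ltP => [lt|ge].
  congr (X _ _ _ _); apply/setP => j; rewrite !inE.
  case: (eqVneq j i) => [->|ji]; first by rewrite eqxx.
  by apply/negbTE; rewrite gt_eqF// (lt_le_trans lt)// theta_le_others.
case: eqP => [thoo|_].
  rewrite thoo; congr (X _ _ _ _); apply/setP => j; rewrite !inE.
  apply/eqP/oo_le; case: (eqVneq j i) => [->|/theta_le_others].
    by rewrite -thoo.
  by rewrite thoo.
congr (X _ _ _ _); rewrite stoppersE; apply/setP => j.
case: (eqVneq j i) => [->|ji].
  by case: eqP => [E|/eqP/negbTE E]; rewrite !inE eqxx ?E ?eqxx ?orbT.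
by case: ifP => _; rewrite !inE ji ?(negbTE ji) ?orbF.
Qed.

Lemma payoff_le_U : payoff X i S w <= U hN X tau n (S i w) w.
Proof.
rewrite payoff_stage /U /Y; case: ltP => // _.
case: (theta N tau n w) => [t|] //=.
by rewrite le_max; case: ifP => _; rewrite lexx ?orbT.
Qed.

End one_stage.

(** [U] sees the others only through their earliest date and who attains it. Once the dates of a
    path are frozen, all later stages of a player thus have the same reward. *)
Lemma U_same_profile (tau : nat -> Omega -> Nbar) n n' S t w :
    (N < n)%N -> (N < n')%N -> player hN n = player hN n' ->
    (forall l, (n - N + 1 <= l < n)%N -> S (player hN l) w = tau l w) ->
    (forall l, (n' - N + 1 <= l < n')%N -> S (player hN l) w = tau l w) ->
  U hN X tau n t w = U hN X tau n' t w.
Proof.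
move=> Nn Nn' e H H'.
by rewrite /U /Y (stoppersE Nn H) (stoppersE Nn' H') (theta_others Nn H)
  (theta_others Nn' H') e.
Qed.

Section limit_stage.
Context (tau : nat -> Omega -> Nbar) (n : nat) (Nn : (N < n)%N).
Local Notation i := (player hN n).
Context (S : 'I_N -> Omega -> Nbar) (w : Omega).
Hypotheses (tau_init : forall n, (1 <= n <= N)%N -> tau n w = oo)
  (tau_step : forall n, (N < n)%N ->
    tau n w = tau (n - N)%N w \/ (tau n w < theta N tau n w)%O).
Hypothesis S_tau : forall l, (n - N + 1 <= l <= n)%N ->
  S (player hN l) w = tau l w.
Hypothesis XA : forall j t, X i [set i; j]%SET t w <= X i [set j]%SET t w.

(** If i does not stop before a finite theta, a single other player j stops first: there is no tie,
    the payoff is the {j} term, and Assumption (A) makes it the larger term of [Y]. *)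
Lemma payoff_eq_U : payoff X i S w = U hN X tau n (S i w) w.
Proof.
have S_tau' l : (n - N + 1 <= l < n)%N -> S (player hN l) w = tau l w.
  by move=> ln; apply: S_tau; lia.
have Si : S i w = tau n w by apply: S_tau; lia.
rewrite (payoff_stage Nn S_tau') /U /Y; case: ltP => //.
have [l1 l1n l1E] := theta_attained hN tau w Nn.
rewrite Si -l1E.
have [alloo|[l0 l0n l0P]] := unique_first hN tau_init tau_step (ltnW Nn).
  by rewrite alloo//; lia.
(* The index l1 attaining theta must be the unique first stopper l0: otherwise l0 = n would stop
   before theta, or l0 would lie in the window with a date below theta. *)
case: (eqVneq l1 l0) => [l10|l10]; last first.
  case: (eqVneq l0 n) => [<-|l0n']; first by rewrite leNgt l0P//; lia.
  have := l0P l1 ltac:(lia) l10.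
  by rewrite ltNge l1E theta_le//; lia.
have lt : (tau l1 w < tau n w)%O.
  by rewrite l10; apply: l0P; [lia|apply/eqP => e; move: l1n; lia].
rewrite (gt_eqF lt).
have -> : stoppers hN tau n w = [set player hN l0]%SET.
  apply/setP => j; rewrite inE; apply/(stoppersP _ _ _ _ Nn)/eqP.
    move=> [l [ln <- lE]]; case: (eqVneq l l0) => [->//|ll0].
    have := l0P l ltac:(lia) ll0.
    by rewrite lE -l1E l10 ltxx.
  by move=> ->; exists l0; split=> //; [lia|rewrite -l10].
case E : (tau l1 w) lt => [t|]; last by rewrite ltNge Nbar_lex1.
by move=> _ _ /=; rewrite max_r// finset.setUC; exact: XA.
Qed.

End limit_stage.
End payoffs.

(** * Stage-wise optimality *)

Lemma measurable_wrt_mono (d d' : measure_display) (Omega : measurableType d)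
    (S : measurableType d') (G H : set (set Omega)) (g : Omega -> S) :
  sigma_algebra setT G -> sigma_algebra setT H -> G `<=` H ->
  measurable_wrt G g -> measurable_wrt H g.
Proof.
move=> sG sH GH mg _ B mB; rewrite setTI (sub_measurableE sH); apply: GH.
exact: (measurable_wrt_preimage sG mg).
Qed.

Lemma Nbar_inf_le (A : set Nbar) t :
  (Nbar_inf A <= Fin t)%O <-> exists2 s, (s <= t)%N & A (Fin s).
Proof.
rewrite /Nbar_inf; case: pselect => [ex|nex].
  case: ex_minnP => m /asboolP Am mP; rewrite Fin_le; split=> [mt|[s st As]].
    by exists m.
  by apply: leq_trans st; apply: mP; apply/asboolP.
split=> // -[s st As]; exfalso; apply: nex; exists s; exact/asboolP.
Qed.

Lemma Nbar_inf_mem (A : set Nbar) t : Nbar_inf A = Fin t -> A (Fin t).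
Proof.
rewrite /Nbar_inf; case: pselect => [ex|//].
by case: ex_minnP => m /asboolP Am _ [<-].
Qed.

Lemma lt_Nbar_inf (A : set Nbar) t : (Fin t < Nbar_inf A)%O -> ~ A (Fin t).
Proof.
by rewrite ltNge => /negP H At; apply: H; apply/Nbar_inf_le; exists t.
Qed.

(** * Adaptedness, domination and stationarity of the stage rewards *)

Section stage_rewards.
Context (d : measure_display) (Omega : measurableType d) (R : realType).
Context (P : probability Omega R) (F : nat -> set (set Omega)) (hF : filtration F).
Context (N : nat) (hN : (1 < N)%N) (T : nat).
Context (X : 'I_N -> {set 'I_N} -> Nbar -> Omega -> R).
Hypotheses
  (X_adapted : forall i (I : {set 'I_N}) t, I != finset.set0 ->
    measurable_wrt (Fbar F t) (X i I t))
  (X_integrable : forall i (I : {set 'I_N}) t, I != finset.set0 ->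
    P.-integrable setT (EFin \o X i I t))
  (X_late : forall i I t w, (Fin T <= t)%O -> X i I t w = X i [set: 'I_N]%SET oo w).

(** One integrable bound for all stage rewards and all payoffs; dates up to T suffice since X is
    constant from T on. *)
Definition dominator (w : Omega) : R :=
  \sum_(i < N) \sum_(I : {set 'I_N} | I != finset.set0) \sum_(s < T.+1)
    `|X i I (Fin s) w|.

Lemma dominator_integrable : P.-integrable setT (EFin \o dominator).
Proof.
have -> : EFin \o dominator = fun w => (\sum_(i < N)
    \sum_(I : {set 'I_N} | I != finset.set0) \sum_(s < T.+1)
    (`|X i I (Fin s) w|)%:E)%E.
  apply/funext => w /=; rewrite /dominator -sumEFin.
  by apply: eq_bigr => i _; rewrite -sumEFin; apply: eq_bigr => I _; rewrite -sumEFin.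
apply: integrable_sum => // i _; apply: integrable_sum => // I I0.
by apply: integrable_sum => // s _; apply: integrable_norm; exact: X_integrable.
Qed.

Lemma X_le_dominator i (I : {set 'I_N}) t w : I != finset.set0 ->
  `|X i I t w| <= dominator w.
Proof.
move=> I0; rewrite /dominator (bigD1 i)//= (bigD1 I)//=.
have bound (s : 'I_T.+1) : `|X i I (Fin s) w| <= \sum_(s < T.+1) `|X i I (Fin s) w|.
  by rewrite (bigD1 s)//= lerDl sumr_ge0.
rewrite -addrA ler_wpDr//.
  by rewrite addr_ge0// !sumr_ge0// => *; rewrite !sumr_ge0// => *; rewrite sumr_ge0.
case: (leP t (Fin T)) => tT.
  case: t tT => [s|//]; rewrite Fin_le -ltnS => sT.
  exact: (bound (Ordinal sT)).
by rewrite X_late ?(ltW tT)// -(@X_late i I (Fin T))//; exact: (bound ord_max).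
Qed.

Section stage.
Context (tau : nat -> Omega -> Nbar) (n : nat) (Nn : (N < n)%N).
Local Notation i := (player hN n).

Lemma U_value t w : exists (I : {set 'I_N}) s, I != finset.set0 /\
  U hN X tau n t w = X i I s w.
Proof.
have st0 := stoppers_neq0 hN tau w Nn.
have i0 (A : {set 'I_N}) : (A :|: [set i])%SET != finset.set0.
  by apply/set0Pn; exists i; rewrite !inE eqxx orbT.
have T0 : [set: 'I_N]%SET != finset.set0 by apply/set0Pn; exists i; rewrite inE.
rewrite /U /Y; case: ifP => _.
  by exists [set i]%SET, t; rewrite -[[set i]%SET]finset.set0U.
case E : (theta N tau n w) => [s|]; last by exists [set: 'I_N]%SET, oo.
rewrite maxElt; case: ifP => _.
  by exists (stoppers hN tau n w), (Some s).
by exists (stoppers hN tau n w :|: [set i])%SET, (Some s).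
Qed.

Lemma U_le_dominator t w : `|U hN X tau n t w| <= dominator w.
Proof.
have [I [s [I0 ->]]] := U_value t w; exact: X_le_dominator.
Qed.

(** From T on, all coalitions pay the same: if theta exceeds T, stopping before or after it makes no
    difference. *)
Lemma U_late t w : (Fin T <= t)%O -> U hN X tau n t w = U hN X tau n (Fin T) w.
Proof.
move=> Tt; rewrite /U; case: ltP => tth; first by rewrite (le_lt_trans Tt tth) !X_late.
case: ltP => // /ltW Tth; rewrite /Y [RHS]X_late ?lexx//.
case E : (theta N tau n w) Tth => [s|//] Ts.
by rewrite !(X_late _ _ _ Ts) maxxx.
Qed.

Lemma U_stopped t w : (theta N tau n w <= t)%O ->
  U hN X tau n t w = U hN X tau n (theta N tau n w) w.
Proof. by move=> tht; rewrite /U !ltNge tht lexx. Qed.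

Hypothesis tau_stop : forall l, (0 < l < n)%N -> stopping_time F (tau l).

Lemma theta_stopping : stopping_time F (theta N tau n).
Proof.
move=> t.
rewrite (_ : [set w | _] = \bigcup_(l : 'I_n)
    if (n - N + 1 <= l)%N then [set w | (tau l w <= Fin t)%O] else set0).
  apply: (sub_algebra_bigcup (filtration_sigma hF t)) => l.
  case: ifP => ln; first by apply: tau_stop; have := ltn_ord l; lia.
  rewrite -(sub_measurableE (filtration_sigma hF t)); exact: measurable0.
apply/seteqP; split=> [w /= tht|w [l _]].
  have [l ln lE] := theta_attained hN tau w Nn.
  have ln' : (l < n)%N by lia.
  exists (Ordinal ln') => //=; rewrite ifT; last by lia.
  by rewrite /= lE.
case: ifP => // ln /=; apply: le_trans; apply: theta_le.
by rewrite ln ltn_ord.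
Qed.

(* U at time t only depends on the other players' dates through their
   truncations at t, which take countably many values. *)
Lemma U_measurable t : measurable_wrt (Fbar F t) (U hN X tau n t).
Proof.
have sF := Fbar_sigma hF t.
pose trunc w (l : nat) : Nbar :=
  if (n - N + 1 <= l)%N && (tau l w <= t)%O then tau l w else oo.
pose K w := [ffun l : 'I_n => (trunc w l : option nat)].
pose ext (c : {ffun 'I_n -> option nat}) (l : nat) : Nbar :=
  if insub l is Some o then c o else oo.
pose h c := U hN X (fun l (_ : Omega) => ext c l) n t.
have extK w l : (n - N + 1 <= l < n)%N ->
    ext (K w) l = if (tau l w <= t)%O then tau l w else oo.
  by move=> /andP[l1 l2]; rewrite /ext insubT ffunE /trunc /= l1.
have UE : U hN X tau n t = fun w => h (K w) w.
  apply/funext => w; rewrite /h.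
  set tau' := fun l _ => ext (K w) l.
  have tau'E l : (n - N + 1 <= l < n)%N ->
      tau' l w = if (tau l w <= t)%O then tau l w else oo by exact: extK.
  (* If theta <= t, truncation keeps theta and those who attain it. Otherwise the truncated minimum
     is oo and both sides are in the branch t < theta. *)
  have th' : theta N tau' n w =
      if (theta N tau n w <= t)%O then theta N tau n w else oo.
    have [l ln lE] := theta_attained hN tau w Nn.
    case: ifP => tht.
      apply/eqP; rewrite eq_le; apply/andP; split.
        by rewrite -lE -[leRHS](_ : tau' l w = _) ?theta_le// tau'E// lE tht.
      apply/theta_geP => k kn; rewrite tau'E//.
      by case: ifP => _; [exact: theta_le|exact: Nbar_lex1].
    apply/oo_le; apply/theta_geP => k kn; rewrite tau'E//; case: ifP => // kt.
    by rewrite (le_trans (theta_le _ _ kn) kt) in tht.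
  rewrite /U; case: (leP (theta N tau n w) t) th' => tht th'; last first.
    by rewrite th' (lt_le_trans tht (Nbar_lex1 _)).
  rewrite th' ltNge tht /= /Y th'.
  suff -> : stoppers hN tau' n w = stoppers hN tau n w by [].
  apply/setP => j; apply/(stoppersP _ _ _ _ Nn)/(stoppersP _ _ _ _ Nn).
    move=> [l [ln lj]]; rewrite th' tau'E//; case: ifP => [_ lE|lt lE].
      by exists l.
    by move: tht lt; rewrite -lE => /oo_le ->; rewrite Nbar_lex1.
  by move=> [l [ln lj lE]]; exists l; rewrite th' tau'E// lE tht.
rewrite UE; apply: (measurable_wrt_countable sF) => c.
  rewrite (_ : [set w | _] = \bigcap_(l : 'I_n) [set w | (trunc w l : option nat) = c l]).
    apply: (sub_algebra_bigcap_fin sF) => l; rewrite /trunc.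
    case: (boolP (n - N + 1 <= l)%N) => ln /=; last first.
      exact: (sub_algebra_cst sF).
    have snu : stopping_time F (tau l) by apply: tau_stop; have := ltn_ord l; lia.
    have := @stopping_time_truncated_set _ _ _ hF (tau l) (c l) t snu.
    exact.
  apply/seteqP; split=> [w /= <- l _ /=|w /= H]; first by rewrite ffunE.
  by apply/ffunP => l; rewrite ffunE; exact: H.
(* For frozen dates, theta and the coalition are constants, read off at an arbitrary [point]. *)
pose th := theta N (fun l (_ : Omega) => ext c l) n point.
pose st := stoppers hN (fun l (_ : Omega) => ext c l) n point.
have st0 : st != finset.set0 by exact: stoppers_neq0.
have -> : h c = fun w => if (t < th)%O then X i [set i]%SET t w else
    if th is Some _ then Num.max (X i (st :|: [set i])%SET th w) (X i st th w)
    else X i [set: 'I_N]%SET oo w by [].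
have i0 (A : {set 'I_N}) : (A :|: [set i])%SET != finset.set0.
  by apply/set0Pn; exists i; rewrite !inE eqxx orbT.
have T0 : [set: 'I_N]%SET != finset.set0 by apply/set0Pn; exists i; rewrite inE.
have mX I s : I != finset.set0 -> (s <= t)%O -> measurable_wrt (Fbar F t) (X i I s).
  move=> I0 st'; apply: (measurable_wrt_mono (Fbar_sigma hF s) sF).
    exact: (Fbar_mono hF).
  exact: X_adapted.
case: ltP => tht.
  by apply: mX => //; rewrite -[[set i]%SET]finset.set0U.
case: th tht => [s|] tht; last exact: mX.
by apply: measurable_maxr; exact: mX.
Qed.

End stage.
End stage_rewards.

(** * Runs of the scheme, for arbitrary versions of the envelopes *)

Section runs_of_the_scheme.
Context (d : measure_display) (Omega : measurableType d) (R : realType).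
Context (P : probability Omega R) (F : nat -> set (set Omega)) (hF : filtration F).
Context (N : nat) (hN : (1 < N)%N) (eps : R) (T : nat).
Context (X : 'I_N -> {set 'I_N} -> Nbar -> Omega -> R).
Hypotheses
  (X_adapted : forall i (I : {set 'I_N}) t, I != finset.set0 ->
    measurable_wrt (Fbar F t) (X i I t))
  (X_integrable : forall i (I : {set 'I_N}) t, I != finset.set0 ->
    P.-integrable setT (EFin \o X i I t))
  (X_late : forall i I t w, (Fin T <= t)%O -> X i I t w = X i [set: 'I_N]%SET oo w).

Lemma U_reward (tau : nat -> Omega -> Nbar) n : (N < n)%N ->
    (forall l, (0 < l < n)%N -> stopping_time F (tau l)) ->
  reward P F T (U hN X tau n).
Proof.
move=> Nn st; have mU := U_measurable hF hN X_adapted Nn st.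
split=> // [t|t w]; last exact: (U_late hN X_late).
apply: (le_integrable measurableT _ _ (dominator_integrable T X_integrable)).
  apply/measurable_EFinP; apply: (measurable_wrt_sub (Fbar_sigma hF t) (@Fbar_sub _ _ _ hF t)).
  exact: mU.
move=> w _ /=; rewrite lee_fin (le_trans (U_le_dominator hN X_late tau Nn t w))//.
exact: ler_norm.
Qed.

Section stopping_rule.
Context (tau : nat -> Omega -> Nbar) (n : nat) (Nn : (N < n)%N).
Context (W : Nbar -> Omega -> \bar R).
Local Notation U := (U hN X tau n).
Local Notation mu := (mu hN eps X tau n W).
Local Notation theta := (theta N tau n).
Hypothesis tau_stop : forall l, (0 < l < n)%N -> stopping_time F (tau l).
Hypothesis WU : snell_envelope P F U W.
Hypothesis tau_n : forall w,
  let m := Order.min (mu w) (tau (n - N)%N w) in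
  tau n w = if (m < theta w)%O then m else tau (n - N)%N w.

Lemma mu_stopping : stopping_time F mu.
Proof.
move=> t; have sF := filtration_sigma hF t.
rewrite (_ : [set w | _] = \bigcup_(s : 'I_t.+1)
    [set w | (W (Fin s) w <= (U (Fin s) w)%:E + eps%:E)%E]).
  apply: (sub_algebra_bigcup sF) => s.
  apply: (@filtration_mono _ _ _ hF s); first by rewrite -ltnS.
  have sFs := filtration_sigma hF s.
  have [mW _] := WU (Fin s).
  have mU := U_measurable hF hN X_adapted Nn tau_stop (t := Fin s).
  rewrite -(sub_measurableE sFs) -[X in measurable X]setTI.
  apply: measurable_lee => //.
  apply: emeasurable_funD; first by apply/measurable_EFinP; exact: mU.
  exact: measurable_cst.
apply/seteqP; split=> w /=.
  move=> /Nbar_inf_le[s st H]; rewrite -ltnS in st.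
  by exists (Ordinal st).
move=> [s _ H]; apply/Nbar_inf_le; exists s => //.
by rewrite -ltnS.
Qed.

(** The test m < theta is decided at time m, as the event s < theta lies in F_s. Paths with
    tau_(n-N) <= t may be added freely, both branches being at most tau_(n-N). *)
Lemma tau_stopping : stopping_time F (tau n).
Proof.
have smu := mu_stopping; have stn : stopping_time F (tau (n - N)%N).
  by apply: tau_stop; lia.
have sth := theta_stopping hF hN Nn tau_stop.
have sm := stopping_time_min hF smu stn.
move=> t; have sF := filtration_sigma hF t.
pose m w := Order.min (mu w) (tau (n - N)%N w).
rewrite (_ : [set w | _] =
    (\bigcup_(s : 'I_t.+1) ([set w | m w = Fin s] `&` [set w | (Fin s < theta w)%O]))
      `|` [set w | (tau (n - N)%N w <= Fin t)%O]).
  apply: (sub_algebraU sF); last exact: stn.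
  apply: (sub_algebra_bigcup sF) => s; apply: (@filtration_mono _ _ _ hF s).
    by rewrite -ltnS.
  apply: (sub_algebraI (filtration_sigma hF s)).
    exact: (stopping_time_eq_set hF (s := Fin s) (t := Fin s) sm).
  exact: (stopping_time_gt_set hF).
apply/seteqP; split=> w /=; rewrite tau_n -/(m w).
  case: ifP => mth mt; last by right.
  left; case E : (m w) mt mth => [s|//]; rewrite Fin_le -ltnS => st mth.
  by exists (Ordinal st).
move=> [[s _ /= [-> ->]]|nt].
  by rewrite Fin_le -ltnS.
case: ifP => // _; apply: le_trans nt; rewrite /m ge_min lexx orbT //.
Qed.

Lemma tau_le w : (tau n w <= tau (n - N)%N w)%O.
Proof. by rewrite tau_n /=; case: ifP => // _; rewrite ge_min lexx orbT. Qed.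

Lemma tau_change w : tau n w = tau (n - N)%N w \/ (tau n w < theta w)%O.
Proof. by rewrite tau_n /=; case: ifP; [right|left]. Qed.

End stopping_rule.

Section run.
Context (tau : nat -> Omega -> Nbar) (htau : scheme P F hN eps X tau).

Lemma scheme_init n w : (1 <= n <= N)%N -> tau n w = oo.
Proof. by case: htau => H _ nN; exact: H. Qed.

Lemma scheme_stopping n : (0 < n)%N -> stopping_time F (tau n).
Proof.
elim/ltn_ind: n => n IH n0; case: (leqP n N) => nN.
  rewrite (_ : tau n = fun=> oo); first exact: stopping_time_cst.
  by apply/funext => w; apply: scheme_init; rewrite n0.
case: htau => _ /(_ n nN)[W WU tauE].
apply: (tau_stopping nN _ WU tauE) => l /andP[l0 ln]; exact: IH.
Qed.

Lemma scheme_mono n w : (N < n)%N -> (tau n w <= tau (n - N)%N w)%O.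
Proof. by case: htau => _ H nN; have [W _ tauE] := H n nN; exact: (tau_le tauE w). Qed.

Lemma scheme_step n w : (N < n)%N ->
  tau n w = tau (n - N)%N w \/ (tau n w < theta N tau n w)%O.
Proof. by case: htau => _ H nN; have [W _ tauE] := H n nN; exact: (tau_change tauE w). Qed.

Lemma scheme_U_reward n : (N < n)%N -> reward P F T (U hN X tau n).
Proof. by move=> Nn; apply: U_reward => // l /andP[l0 _]; exact: scheme_stopping. Qed.

Lemma scheme_theta_stopping n : (N < n)%N -> stopping_time F (theta N tau n).
Proof. by move=> Nn; apply: theta_stopping => // l /andP[l0 _]; exact: scheme_stopping. Qed.

(* A player who stops before the others did so, for the first time, at an
   eps-optimal date, and since then no other player has changed. *)
Lemma snell_le_at_tau n : (N < n)%N ->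
  {ae P, forall w, (tau n w < theta N tau n w)%O ->
    snell P F T (U hN X tau n) (tau n w) w <= U hN X tau n (tau n w) w + eps}.
Proof.
elim/ltn_ind: n => n IH Nn.
case: (htau) => _ /(_ n Nn)[W WU tauE].
have Un := scheme_U_reward Nn.
have aeW1 : {ae P, forall w (s : nat),
    W (Fin s) w = (snell P F T (U hN X tau n) (Fin s) w)%:E}.
  by apply/ae_foralln => s; exact: (snell_envelope_unique hF Un WU).
have aeW2 : {ae P, forall w, (tau (n - N)%N w < theta N tau n w)%O ->
    snell P F T (U hN X tau n) (tau (n - N)%N w) w <=
    U hN X tau n (tau (n - N)%N w) w + eps}.
  case: (leqP (n - N) N) => nN.
    apply: aeW => w; rewrite scheme_init; last by lia.
    by rewrite ltNge Nbar_lex1.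
  have Un' := scheme_U_reward nN.
  (* The rewards of stages n and n - N agree on this event, which lies in F_s, so [snell_local]
     applies for each value s of the old date. *)
  pose B s := [set w | tau (n - N)%N w = Fin s] `&`
    [set w | (Fin s < theta N tau n w)%O].
  have FB s : F s (B s).
    apply: (sub_algebraI (filtration_sigma hF s)).
      apply: (stopping_time_eq_set hF (s := Fin s) (t := Fin s)) => //.
      by apply: scheme_stopping; lia.
    by apply: (stopping_time_gt_set hF); exact: scheme_theta_stopping.
  have loc : {ae P, forall w (s : nat), B s w ->
      snell P F T (U hN X tau n) (Fin s) w =
      snell P F T (U hN X tau (n - N)) (Fin s) w}.
    apply/ae_foralln => s.
    apply: (snell_local hF (t := Fin s) Un Un' (FB s)) => w t [/= taus sth].
    apply: U_no_change => //.
    - by move=> k; exact: scheme_init.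
    - by move=> k; exact: scheme_step.
    - by rewrite taus.
  apply: filterS2 loc (IH _ _ nN) => [w|]; last by lia.
  move=> loc IHw lt.
  have init k : (1 <= k <= N)%N -> tau k w = oo by exact: scheme_init.
  have step k (Nk : (N < k)%N) := scheme_step w Nk.
  have UE t := U_no_change hN init step X t Nn lt.
  have thE := theta_no_change hN init step Nn lt.
  rewrite UE; have := IHw; rewrite -thE => /(_ lt).
  have [s E] : exists s, tau (n - N)%N w = Fin s.
    case: (tau (n - N)%N w) lt => [s _|]; first by exists s.
    by rewrite ltNge Nbar_lex1.
  by rewrite E in lt *; rewrite loc.
(* Either tau_n = mu_n, where the bound defines mu_n, or tau_n is the old date, where it is
   inherited. *)
apply: filterS2 aeW1 aeW2 => w H1 H2; rewrite tauE /=.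
case: ifP => [mth _|nlt lt]; last exact: H2.
move: mth; case: (leP (mu hN eps X tau n W w) (tau (n - N)%N w)) => [_ muth|_];
  last exact: H2.
case E : (mu hN eps X tau n W w) muth => [s|]; last by rewrite ltNge Nbar_lex1.
move=> muth; by have := Nbar_inf_mem E; rewrite /= H1 -EFinD lee_fin.
Qed.

Lemma stage_optimal n (nu : Omega -> Nbar) :
    0 < eps -> (N < n)%N -> stopping_time F nu ->
  \int[P]_w U hN X tau n (nu w) w <= \int[P]_w U hN X tau n (tau n w) w + eps.
Proof.
move=> heps Nn snu; have Un := scheme_U_reward Nn.
case: (htau) => _ /(_ n Nn)[W WU tauE].
have sth := scheme_theta_stopping Nn.
have stn : stopping_time F (tau n) by apply: scheme_stopping; lia.
(* When the old date is kept, tau_n may exceed mu_n, but only if mu_n >= theta_n or tau_n = theta_n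
   at most matters: capping at theta_n, where U^n freezes, keeps the reward and puts sigma below
   mu_n. *)
pose sigma w := Order.min (tau n w) (theta N tau n w).
have Usigma w : U hN X tau n (tau n w) w = U hN X tau n (sigma w) w.
  rewrite /sigma; case: leP => // /ltW; exact: U_stopped.
under [in leRHS]eq_Rintegral do rewrite Usigma.
have aeW1 : {ae P, forall w (s : nat),
    W (Fin s) w = (snell P F T (U hN X tau n) (Fin s) w)%:E}.
  by apply/ae_foralln => s; exact: (snell_envelope_unique hF Un WU).
have aeth : {ae P, forall w (s : nat), (theta N tau n w <= Fin s)%O ->
    snell P F T (U hN X tau n) (Fin s) w = U hN X tau n (Fin s) w}.
  apply/ae_foralln => s.
  apply: (snell_absorbed hF Un (t := Fin s) (sth s)) => w t /= ths st.
  by rewrite [LHS]U_stopped ?(le_trans ths)// [RHS]U_stopped.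
apply: (eps_optimal hF Un) => //; first exact: (stopping_time_min hF).
  apply: filterS aeW1 => w H s sT ssigma.
  (* sigma <= mu_n: either tau_n = m <= mu_n, or theta_n <= m <= mu_n. *)
  have smu : (Fin s < mu hN eps X tau n W w)%O.
    apply: (lt_le_trans ssigma); rewrite /sigma tauE /=.
    case: ifP => [_|/negbT]; first by rewrite !ge_min lexx.
    by rewrite -leNgt le_min => /andP[thmu _]; rewrite ge_min thmu orbT.
  have := lt_Nbar_inf smu; rewrite /= H -EFinD lee_fin => /negP.
  by rewrite -ltNge; apply: le_lt_trans; rewrite lerDl ltW.
(* At sigma, either tau_n comes first and the inherited bound applies, or theta_n does and V = U
   there, at oo by [snell_late]. *)
apply: filterS2 aeth (snell_le_at_tau Nn) => w H1 H2; rewrite /sigma.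
case: (ltP (tau n w) (theta N tau n w)) => [lt|_]; first exact: H2.
case E : (theta N tau n w) => [s|]; last by rewrite (snell_late Un)// lerDl ltW.
by rewrite H1 ?E// lerDl ltW.
Qed.

End run.
End runs_of_the_scheme.

(** * Existence and limit of the scheme *)

Section existence_and_equilibrium.
Context (d : measure_display) (Omega : measurableType d) (R : realType).
Context (P : probability Omega R) (F : nat -> set (set Omega)) (hF : filtration F).
Context (N : nat) (hN : (1 < N)%N) (eps : R) (T : nat).
Context (X : 'I_N -> {set 'I_N} -> Nbar -> Omega -> R).
Hypotheses
  (X_adapted : forall i (I : {set 'I_N}) t, I != finset.set0 ->
    measurable_wrt (Fbar F t) (X i I t))
  (X_integrable : forall i (I : {set 'I_N}) t, I != finset.set0 ->
    P.-integrable setT (EFin \o X i I t))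
  (X_late : forall i I t w, (Fin T <= t)%O -> X i I t w = X i [set: 'I_N]%SET oo w).

Section existence.

Definition greedy_step (tau : nat -> Omega -> Nbar) (n : nat) (w : Omega) : Nbar :=
  let W t w := (snell P F T (U hN X tau n) t w)%:E in
  let m := Order.min (mu hN eps X tau n W w) (tau (n - N)%N w) in
  if (m < theta N tau n w)%O then m else tau (n - N)%N w.

(* [greedy_upto k] is correct at the indices below [k]; recursion on [k] stands
   for the course-of-values recursion of the scheme. *)
Fixpoint greedy_upto (k : nat) : nat -> Omega -> Nbar :=
  if k is j.+1 then
    fun n => if (n == j) && (N < n)%N then greedy_step (greedy_upto j) n
             else greedy_upto j n
  else fun _ _ => oo.

Definition greedy (n : nat) : Omega -> Nbar := greedy_upto n.+1 n.

Lemma greedy_uptoE k l : (l < k)%N -> greedy_upto k l = greedy l.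
Proof.
elim: k => // k IH; rewrite ltnS leq_eqVlt => /predU1P[->//|lk].
by rewrite /= (ltn_eqF lk)/= IH.
Qed.

Lemma greedy_init n : (n <= N)%N -> greedy n = fun=> oo.
Proof.
rewrite /greedy => nN; elim: n.+1 => //= k IH.
by rewrite [(N < n)%N]ltnNge nN andbF.
Qed.

Lemma greedy_step_ext tau1 tau2 n : (N < n)%N ->
  (forall l, (l < n)%N -> tau1 l = tau2 l) ->
  greedy_step tau1 n = greedy_step tau2 n.
Proof.
move=> Nn e12.
have thE : theta N tau1 n = theta N tau2 n.
  by apply/funext => w; apply: eq_big_nat => l /andP[_ ln]; rewrite e12.
have stE w : stoppers hN tau1 n w = stoppers hN tau2 n w.
  apply/setP => j; apply/(stoppersP _ _ _ _ Nn)/(stoppersP _ _ _ _ Nn).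
    by move=> [l [ln lj lE]]; exists l; rewrite -thE -e12//; case/andP: ln.
  by move=> [l [ln lj lE]]; exists l; rewrite thE e12//; case/andP: ln.
have UE : U hN X tau1 n = U hN X tau2 n.
  by apply/funext => t; apply/funext => w; rewrite /U /Y thE stE.
apply/funext => w; rewrite /greedy_step /mu UE thE e12//; lia.
Qed.

Lemma greedyE n : (N < n)%N -> greedy n = greedy_step greedy n.
Proof.
move=> Nn; rewrite /greedy /= eqxx Nn /=.
by apply: greedy_step_ext => // l ln; rewrite greedy_uptoE.
Qed.

Lemma greedy_envelope n : (N < n)%N ->
  (forall l, (0 < l < n)%N -> stopping_time F (greedy l)) ->
  snell_envelope P F (U hN X greedy n)
    (fun t w => (snell P F T (U hN X greedy n) t w)%:E).
Proof.
by move=> Nn st; apply: snell_is_envelope => //; exact: U_reward.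
Qed.

(** Strong induction, because [snell] is an envelope at stage n only once the earlier dates are
    stopping times, and tau_n is a stopping time only through that envelope. *)
Lemma greedy_stopping n : (0 < n)%N -> stopping_time F (greedy n).
Proof.
elim/ltn_ind: n => n IH n0; case: (leqP n N) => nN.
  by rewrite greedy_init//; exact: stopping_time_cst.
have st l : (0 < l < n)%N -> stopping_time F (greedy l).
  by move=> /andP[l0 ln]; exact: IH.
apply: (tau_stopping hF X_adapted nN st (greedy_envelope nN st) (eps := eps)) => w /=.
by rewrite [LHS](congr1 (@^~ w) (greedyE nN)).
Qed.

Lemma scheme_exists : scheme P F hN eps X greedy.
Proof.
split=> [n /andP[_ nN] w|n Nn]; first by rewrite greedy_init.
exists (fun t w => (snell P F T (U hN X greedy n) t w)%:E).
  by apply: greedy_envelope => // l /andP[l0 _]; exact: greedy_stopping.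
by move=> w /=; rewrite [LHS](congr1 (@^~ w) (greedyE Nn)).
Qed.

End existence.

Lemma payoff_le_dominator i (S : 'I_N -> Omega -> Nbar) w :
  `|payoff X i S w| <= dominator T X w.
Proof.
rewrite (payoffE hN); apply: X_le_dominator => //.
have [j jE] := first_stop_attained hN S w.
by apply/set0Pn; exists j; rewrite inE jE.
Qed.

(** A profile takes countably many values; freezing it makes the coalition and the date
    constants. *)
Lemma payoff_measurable i (S : 'I_N -> Omega -> Nbar) :
  (forall j, stopping_time F (S j)) -> measurable_fun setT (payoff X i S).
Proof.
move=> stS.
pose h (c : {ffun 'I_N -> option nat}) : Omega -> R :=
  payoff X i (fun j _ => (c j : Nbar)).
pose K w := [ffun j => (S j w : option nat)].
have -> : payoff X i S = fun w => h (K w) w.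
  apply/funext => w; rewrite /h !(payoffE hN).
  have -> : first_stop (fun j _ => (K w j : Nbar)) w = first_stop S w.
    by apply: eq_bigr => j _; rewrite ffunE.
  by congr (X _ _ _ _); apply/setP => j; rewrite !inE ffunE.
apply: measurable_countable => c.
  rewrite (_ : [set w | _] = \bigcap_(j : 'I_N) [set w | S j w = c j]).
    apply: fin_bigcap_measurable; first exact: finite_finset.
    by move=> j _; exact: (stopping_time_measurable hF).
  apply/seteqP; split=> [w /= <- j _ /=|w /= H]; first by rewrite ffunE.
  by apply/ffunP => j; rewrite ffunE; exact: H.
pose r := first_stop (fun j (_ : Omega) => (c j : Nbar)) point.
pose A := [set j | (c j : Nbar) == r]%SET.
have -> : h c = X i A r by apply/funext => w; rewrite /h (payoffE hN).
apply: (measurable_wrt_sub (Fbar_sigma hF r) (@Fbar_sub _ _ _ hF r)).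
apply: X_adapted.
have [j jE] := first_stop_attained hN (fun j (_ : Omega) => (c j : Nbar)) point.
by apply/set0Pn; exists j; rewrite inE jE.
Qed.

Lemma payoff_integrable i (S : 'I_N -> Omega -> Nbar) :
  (forall j, stopping_time F (S j)) ->
  P.-integrable setT (EFin \o payoff X i S).
Proof.
move=> stS.
apply: (le_integrable measurableT _ _ (dominator_integrable T X_integrable)).
  by apply/measurable_EFinP; exact: payoff_measurable.
move=> w _ /=; rewrite lee_fin (le_trans (payoff_le_dominator i S w))//.
exact: ler_norm.
Qed.

(** * Passage to the limit along the stages of one player *)

Section equilibrium.
Context (tau : nat -> Omega -> Nbar) (htau : scheme P F hN eps X tau).

Let tau_mono w n := @scheme_mono _ _ _ _ _ _ _ _ _ _ htau n w.

Lemma scheme_limit_stopping (i : 'I_N) : stopping_time F (scheme_limit tau i).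
Proof.
move=> t; have sF := filtration_sigma hF t.
rewrite (_ : [set w | _] =
    \bigcup_q [set w | (tau (N * q + i.+1)%N w <= Fin t)%O]).
  apply: (sub_algebra_bigcup sF) => q.
  by apply: (scheme_stopping hF X_adapted htau); rewrite addnS.
apply/seteqP; split=> w /=.
  have [q0 H] := scheme_limit_stationary hN (tau_mono w) i.
  by rewrite -(H q0)// => lt; exists q0.
move=> [q _ /=]; apply: le_trans.
exact: (scheme_limit_le hN (tau_mono w)).
Qed.

Hypothesis heps : 0 < eps.
Hypothesis X_A : {ae P, forall w i j t,
  X i [set i; j]%SET t w <= X i [set j]%SET t w}.

Lemma scheme_limit_nash i (S' : Omega -> Nbar) : stopping_time F S' ->
  \int[P]_w payoff X i (fun j => if j == i then S' else scheme_limit tau j) w <=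
  \int[P]_w payoff X i (scheme_limit tau) w + eps.
Proof.
move=> sS'.
(* The stages of player i, from the second round on so that each exceeds N. *)
pose n q := (N * q.+1 + i.+1)%N.
have Nn q : (N < n q)%N by rewrite /n mulnS; lia.
have pn q : player hN (n q) = i by exact: player_index.
have stS j : stopping_time F (if j == i then S' else scheme_limit tau j).
  by case: ifP => _ //; exact: scheme_limit_stopping.
set S := fun j => if j == i then S' else scheme_limit tau j.
have stable w : exists q0, forall q, (q0 <= q)%N ->
    forall l, (n q - N + 1 <= l)%N -> scheme_limit tau (player hN l) w = tau l w.
  have [L HL] := scheme_stable hN (tau_mono w).
  exists L => q Lq l ln; apply/esym/HL.
  have qNq : (q <= N * q)%N by rewrite leq_pmull// ltnW.
  by move: ln; rewrite /n mulnS; lia.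
have [q0 q0P] := choice stable.
have reward_n q := scheme_U_reward hF X_adapted X_integrable X_late htau (Nn q).
have stn q : stopping_time F (tau (n q)).
  by apply: (scheme_stopping hF X_adapted htau); rewrite /n addnS.
(* The limit reward is that of stage n (q0 w), a stage depending on the path. Since [q0] comes from
   a choice, its measurability is obtained from the convergence. *)
have limit_cvg (nu_ : nat -> Omega -> Nbar) nu : (forall q, stopping_time F (nu_ q)) ->
    (forall w q, (q0 w <= q)%N -> nu_ q w = nu w) ->
    P.-integrable setT (EFin \o (fun w => U hN X tau (n (q0 w)) (nu w) w)) /\
    ((fun q => \int[P]_w U hN X tau (n q) (nu_ q w) w) @ \oo -->
      \int[P]_w U hN X tau (n (q0 w)) (nu w) w).
  move=> snu nuE.
  apply: (cvg_Rintegral_stationary _ (dominator_integrable T X_integrable)).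
  - move=> q; apply/measurable_EFinP.
    exact: (measurable_int P (integrable_reward hF (reward_n q) (snu q))).
  - by move=> q w; exact: U_le_dominator.
  - move=> w; exists (q0 w) => q q0q; rewrite nuE//.
    apply: (@U_same_profile _ _ _ _ _ _ _ _ _ (scheme_limit tau)) => //.
    - by rewrite !pn.
    - by move=> l /andP[ln _]; apply: (q0P w q).
    - by move=> l /andP[ln _]; apply: (q0P w (q0 w)).
have [i1 c1] := limit_cvg (fun=> S') S' (fun=> sS') (fun _ _ _ => erefl).
have tauE w q : (q0 w <= q)%N -> tau (n q) w = scheme_limit tau i w.
  by move=> q0q; rewrite -(q0P w q q0q) ?pn//; have := Nn q; lia.
have [i2 c2] := limit_cvg (fun q => tau (n q)) (scheme_limit tau i) stn tauE.
apply: (@le_trans _ _ (\int[P]_w U hN X tau (n (q0 w)) (S' w) w)).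
  apply: le_Rintegral => //; first exact: payoff_integrable.
  move=> w _; have := @payoff_le_U _ _ _ _ hN X tau (n (q0 w)) (Nn _) S w.
  rewrite pn /S eqxx; apply=> l ln.
  have /negbTE -> : player hN l != i by rewrite -(pn (q0 w)); exact: player_neq.
  by apply: (q0P w (q0 w)) => //; case/andP: ln.
apply: (@le_trans _ _ (\int[P]_w U hN X tau (n (q0 w)) (scheme_limit tau i w) w + eps)).
  apply: (ler_cvg_to c1 (cvgD c2 (cvg_cst eps))).
  by apply: nearW => q; exact: (stage_optimal hF X_adapted X_integrable X_late htau).
rewrite lerD2r le_eqVlt; apply/orP; left; apply/eqP.
apply: ae_eq_Rintegral => //.
  by apply: payoff_integrable => j; exact: scheme_limit_stopping.
apply: filterS X_A => w XAw _.
have := @payoff_eq_U _ _ _ _ hN X tau (n (q0 w)) (Nn _) (scheme_limit tau) w.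
rewrite pn => -> //.
- by move=> k; exact: (scheme_init htau).
- by move=> k; exact: (scheme_step htau).
- by move=> l ln; apply: (q0P w (q0 w)) => //; case/andP: ln.
Qed.

End equilibrium.
End existence_and_equilibrium.

(** * The finite-horizon game *)

Section infinite_extension.
Context (d : measure_display) (Omega : measurableType d) (R : realType).
Context (P : probability Omega R) (F : nat -> set (set Omega)) (hF : filtration F).
Context (N : nat) (hN : (1 < N)%N) (T : nat).
Context (Xt : 'I_N -> {set 'I_N} -> nat -> Omega -> R).
Hypothesis hXt : horizon_assumptions P F T Xt.
Local Notation X := (infinite_extension T Xt).

Lemma setT_neq0 : [set: 'I_N]%SET != finset.set0.
Proof. by apply/set0Pn; exists (Ordinal (ltnW hN)); rewrite inE. Qed.

Lemma extension_late i I t w : (Fin T <= t)%O ->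
  X i I t w = X i [set: 'I_N]%SET oo w.
Proof. by case: t => [s|//]; rewrite Fin_le /= ltnNge => ->. Qed.

Lemma extension_adapted i (I : {set 'I_N}) t : I != finset.set0 ->
  measurable_wrt (Fbar F t) (X i I t).
Proof.
move=> I0; have [aX _ _ _] := hXt.
have late u : (Fin T <= u)%O -> measurable_wrt (Fbar F u) (Xt i [set: 'I_N]%SET T).
  move=> Tu; apply: (measurable_wrt_mono (filtration_sigma hF T) (Fbar_sigma hF u)).
    exact: (Fbar_mono hF Tu).
  by apply: aX => //; exact: setT_neq0.
case: (leP (Fin T) t) => [Tt|].
  rewrite (_ : X i I t = Xt i [set: 'I_N]%SET T); first exact: late.
  by apply/funext => w; rewrite extension_late.
case: t => [s|]; last by rewrite ltNge Nbar_lex1.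
rewrite Fin_lt => sT; rewrite (_ : X i I _ = Xt i I s); last first.
  by apply/funext => w /=; rewrite sT.
by apply: aX => //; exact: ltnW.
Qed.

Lemma horizon_integrable i (I : {set 'I_N}) s : I != finset.set0 -> (s <= T)%N ->
  P.-integrable setT (EFin \o Xt i I s).
Proof.
move=> I0 sT; have [aX iX _ _] := hXt.
have mX t : (t <= T)%N -> measurable_fun setT (Xt i I t).
  move=> tT; apply: (measurable_wrt_sub (filtration_sigma hF t) (@filtration_sub _ _ _ hF t)).
  exact: aX.
have mmax (r : seq 'I_T.+1) :
    measurable_fun setT (fun w => \big[Num.max/0]_(t <- r) `|Xt i I t w|).
  elim: r => [|t r IH].
    by under eq_fun do rewrite big_nil; exact: measurable_cst.
  under eq_fun do rewrite big_cons.
  apply: measurable_maxr => //; apply: measurableT_comp => //.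
  by apply: mX; rewrite -ltnS.
apply/integrableP; split; first by apply/measurable_EFinP; exact: mX.
apply: le_lt_trans (iX i I I0); rewrite unlock; apply: ge0_le_integral => //.
- by apply/measurable_EFinP; apply: measurableT_comp => //; exact: mX.
- by apply/measurable_EFinP; exact: mmax.
- move=> w _ /=; rewrite lee_fin; rewrite -ltnS in sT.
  exact: (le_bigmax _ (fun t : 'I_T.+1 => `|Xt i I t w|) (Ordinal sT)).
Qed.

Lemma extension_integrable i (I : {set 'I_N}) t : I != finset.set0 ->
  P.-integrable setT (EFin \o X i I t).
Proof.
move=> I0; case: (leP (Fin T) t) => [Tt|].
  rewrite (_ : X i I t = Xt i [set: 'I_N]%SET T).
    by apply: horizon_integrable => //; exact: setT_neq0.
  by apply/funext => w; rewrite extension_late.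
case: t => [s|]; last by rewrite ltNge Nbar_lex1.
rewrite Fin_lt => sT; rewrite (_ : X i I _ = Xt i I s); last first.
  by apply/funext => w /=; rewrite sT.
by apply: horizon_integrable => //; exact: ltnW.
Qed.

(** One null set serves all players and dates: the pairs are finitely many, the dates before T
    countable, both sides coincide from T on, and i = j is trivial. *)
Lemma extension_A : {ae P, forall w i j t,
  X i [set i; j]%SET t w <= X i [set j]%SET t w}.
Proof.
have [_ _ hA _] := hXt.
have : {ae P, forall w (ij : 'I_N * 'I_N) (s : nat), (s <= T)%N -> ij.1 != ij.2 ->
    Xt ij.1 [set ij.1; ij.2]%SET s w <= Xt ij.1 [set ij.2]%SET s w}.
  apply: filter_forall => -[i j]; apply/ae_foralln => s /=.
  case: (boolP ((s <= T)%N && (i != j))) => [/andP[sT ij]|].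
    by apply: filterS (hA s i j sT ij) => w.
  by rewrite negb_and => /orP[/negbTE nT|/negbTE nij]; apply: aeW => w; rewrite ?nT ?nij.
apply: filterS => w H i j t.
case: (leP (Fin T) t) => [Tt|]; first by rewrite !(extension_late _ _ _ Tt).
case: t => [s|]; last by rewrite ltNge Nbar_lex1.
rewrite Fin_lt => sT /=; rewrite sT.
case: (eqVneq i j) => [->|ij]; first by rewrite finset.setUid.
by apply: (H (i, j)) => //; exact: ltnW.
Qed.

(** If nobody stops before T, truncation makes everybody stop at T, and the coalition is that of all
    players, as in X from T on. Otherwise truncation alters neither the first date nor who attains
    it. *)
Lemma payoff_truncated i (S : 'I_N -> Omega -> Nbar) w :
  payoff X i S w = finite_payoff Xt i (fun j w' => Order.min (S j w') (Fin T)) w.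
Proof.
rewrite /finite_payoff !(payoffE hN).
set S' := fun j w' => Order.min (S j w') (Fin T).
have -> : first_stop S' w = Order.min (first_stop S w) (Fin T).
  apply/eqP; rewrite eq_le; apply/andP; split.
    rewrite le_min; apply/andP; split.
      apply/first_stop_geP => j; apply: (le_trans (first_stop_le S' w j)).
      by rewrite /S' ge_min lexx.
    apply: (le_trans (first_stop_le S' w (Ordinal (ltnW hN)))).
    by rewrite /S' ge_min lexx orbT.
  apply/first_stop_geP => j; rewrite /S' le_min !ge_min first_stop_le/=.
  by rewrite lexx orbT.
case: (leP (Fin T) (first_stop S w)) => [Tr|rT].
  rewrite extension_late// [LHS]/= (_ : [set j | _]%SET = [set: 'I_N]%SET)//.
  apply/setP => j; rewrite !inE /S' min_r ?eqxx//.
  exact: (le_trans Tr (first_stop_le S w j)).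
have -> : [set j | S' j w == first_stop S w]%SET = [set j | S j w == first_stop S w]%SET.
  apply/setP => j; rewrite !inE /S'; case: (leP (S j w) (Fin T)) => // Tj.
  by rewrite (gt_eqF rT) (gt_eqF (lt_trans rT Tj)).
case: (first_stop S w) rT => [s|]; last by rewrite ltNge Nbar_lex1.
by rewrite Fin_lt /= => ->.
Qed.

End infinite_extension.
Theorem corollary4p6 (R : realType) (d : measure_display)
    (Omega : measurableType d) (P : probability Omega R)
    (F : nat -> set (set Omega)) (hF : filtration F)
    (N : nat) (hN : (1 < N)%N) (eps : R) (heps : 0 < eps)
    (T : nat) (hT : (1 <= T)%N)
    (Xt : 'I_N -> {set 'I_N} -> nat -> Omega -> R)
    (hXt : horizon_assumptions P F T Xt) :
  let X := infinite_extension T Xt in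
  [/\ (* (i) *)
      assumption_A P X,
      (* (ii), existence of the objects defined by the scheme *)
      (exists tau : nat -> Omega -> Nbar, scheme P F hN eps X tau),
      (* (ii), for every choice of versions in the scheme *)
      (forall tau : nat -> Omega -> Nbar, scheme P F hN eps X tau ->
        [/\ forall (i : 'I_N) (q : nat), stopping_time F (tau (N * q + i.+1)%N),
            forall (i : 'I_N) (w : Omega),
              tau i.+1 w = oo /\
              nonincreasing_seq (fun q : nat => tau (N * q + i.+1)%N w),
            forall (i : 'I_N) (w : Omega),
              (fun q : nat => tau (N * q + i.+1)%N w) @ \oo
                --> scheme_limit tau i w &
            nash P (stopping_time F) (payoff X) eps (scheme_limit tau)]),
      (* (iii), identity of the payoffs *)
      (forall S : 'I_N -> Omega -> Nbar, (forall j, stopping_time F (S j)) ->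
        forall i : 'I_N, {ae P, forall w,
          payoff X i S w =
          finite_payoff Xt i (fun j w' => Order.min (S j w') (Fin T)) w}) &
      (* (iii), equilibrium of the finite-horizon game *)
      (forall tau : nat -> Omega -> Nbar, scheme P F hN eps X tau ->
        let Tt := fun i w => Order.min (scheme_limit tau i w) (Fin T) in
        (forall i : 'I_N, stopping_time_le F T (Tt i)) /\
        nash P (stopping_time_le F T) (finite_payoff Xt) eps Tt)].
Proof.
have aX := extension_adapted hF hN hXt.
have iX := extension_integrable hF hN hXt.
have lX i I t w : (Fin T <= t)%O -> infinite_extension T Xt i I t w =
    infinite_extension T Xt i [set: 'I_N]%SET oo w by exact: extension_late.
have AX := extension_A hXt.
move=> X.
have nashX tau : scheme P F hN eps X tau ->
    nash P (stopping_time F) (payoff X) eps (scheme_limit tau).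
  move=> htau; have sT i := scheme_limit_stopping hF aX htau i.
  split=> // i S' sS'; apply: expectation_le_add.
  - by apply: (payoff_integrable hF hN aX iX lX) => j; case: ifP.
  - exact: (payoff_integrable hF hN aX iX lX).
  - exact: (scheme_limit_nash hF aX iX lX htau heps AX).
split.
- by move=> i j t; apply: filterS AX => w; exact.
- by exists (greedy P F hN eps T X); exact: scheme_exists.
- move=> tau htau; split.
  + by move=> i q; apply: (scheme_stopping hF aX htau); rewrite addnS.
  + move=> i w; split; first by apply: (scheme_init htau); rewrite ltn_ord.
    apply/nonincreasing_seqP => q.
    by apply: (tau_index_mono hN) => n; exact: (scheme_mono htau).
  + by move=> i w; apply: (scheme_limit_cvg hN) => n; exact: (scheme_mono htau).
  + exact: nashX.
- by move=> S _ i; apply: aeW => w; exact: payoff_truncated.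
move=> tau htau Tt; have [sT opt] := nashX tau htau.
have sTt i : stopping_time_le F T (Tt i).
  split; first by apply: (stopping_time_min hF) => //; exact: (stopping_time_cst hF).
  by move=> w; rewrite /Tt ge_min lexx orbT.
do 2 split=> //; move=> i S' [sS' S'T].
(* A deviation bounded by T is also one of the infinite-horizon game, and truncating at T leaves it
   unchanged. *)
have := opt i S' sS'.
have -> : payoff X i (scheme_limit tau) = finite_payoff Xt i Tt.
  by apply/funext => w; rewrite payoff_truncated.
suff -> : payoff X i (fun j => if j == i then S' else scheme_limit tau j) =
    finite_payoff Xt i (fun j => if j == i then S' else Tt j) by [].
apply/funext => w; rewrite payoff_truncated//; congr (finite_payoff Xt i _ w).
apply/funext => j; apply/funext => w'; case: ifP => // _.
by rewrite min_l.
Qed.
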